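(* For every integer $t\geq 4$, every graph $G$ that does not contain $K_t$ as a minor has a connected partition $H_1,\dots,H_\ell$ of width $t-2$ such that for every $i\in\{1,\dots,\ell\}$: (1) (a) $H_i$ has maximum degree at most $t-2$; (b) $H_i$ has bandwidth, pathwidth and treewidth at most $t-3$; (c) $H_i$ can be $2$-coloured with clustering $\lceil\tfrac12(t-2)\rceil$; (d) $H_i$ can be $2$-coloured with colours red and blue such that there are at most $t-4$ red vertices and the blue subgraph consists of at most $t-3$ pairwise vertex-disjoint paths; (2) every connected component $C$ of $G-(V(H_1)\cup\dots\cup V(H_i))$ satisfies: (a) at most $t-2$ of the subgraphs $H_1,\dots,H_i$ are adjacent to $C$, and these subgraphs are pairwise adjacent; (b) every vertex of $C$ is adjacent to at most $2t-6$ vertices in each of $H_1,\dots,H_i$.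
   Context: All graphs are finite and simple. A sequence $H_1,\dots,H_\ell$ is a connected partition of $G$ if each $H_i$ is a non-empty connected induced subgraph of $G$, the $H_i$ are pairwise vertex-disjoint, and $V(G)=V(H_1)\cup\dots\cup V(H_\ell)$. Two disjoint subgraphs are adjacent if some edge of $G$ joins them. A connected partition has width $k$ if for each $i\in\{1,\dots,\ell-1\}$, each component of $G-(V(H_1)\cup\dots\cup V(H_i))$ is adjacent to at most $k$ of $H_1,\dots,H_i$. A graph has bandwidth at most $k$ if its vertices can be ordered $v_1,\dots,v_n$ with $|i-j|\le k$ for each edge $v_iv_j$. A graph is $2$-colourable with clustering $c$ if its vertices can be given one of $2$ colours so that every connected component of each colour class has at most $c$ vertices. *)

(* Defs.v *)
From mathcomp Require Import all_boot.

Set Implicit Arguments.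
Unset Strict Implicit.
Unset Printing Implicit Defensive.

Record sgraph := SGraph {
  vertex :> finType;
  edge : rel vertex;
  edge_sym : symmetric edge;
  edge_irrefl : irreflexive edge }.

Notation "x -- y" := (edge x y) (at level 30, no associativity).

Section Induced.
Variables (G : sgraph) (A : {set G}).

Definition induced_edge : rel {x : G | x \in A} := fun x y => val x -- val y.

Lemma induced_edge_sym : symmetric induced_edge.
Proof. by move=> x y; apply: edge_sym. Qed.

Lemma induced_edge_irrefl : irreflexive induced_edge.
Proof. by move=> x; apply: edge_irrefl. Qed.

Definition induced : sgraph := SGraph induced_edge_sym induced_edge_irrefl.

End Induced.

Section Complete.
Variable t : nat.

Definition complete_edge : rel 'I_t := fun x y => x != y.

Lemma complete_edge_sym : symmetric complete_edge.
Proof. by move=> x y; rewrite /complete_edge eq_sym. Qed.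

Lemma complete_edge_irrefl : irreflexive complete_edge.
Proof. by move=> x; rewrite /complete_edge eqxx. Qed.

Definition complete_graph : sgraph :=
  SGraph complete_edge_sym complete_edge_irrefl.

End Complete.

Section Basic.
Variable G : sgraph.
Implicit Types A B : {set G}.

Definition edge_in A : rel G := [rel x y | [&& x \in A, y \in A & x -- y]].

(* The empty set counts as connected; non-emptiness is required separately
   wherever it matters. *)
Definition connected_set A : Prop :=
  {in A &, forall x y, connect (edge_in A) x y}.

(* The vertex sets of the connected components of the subgraph induced by A. *)
Definition components A : {set {set G}} :=
  equivalence_partition (connect (edge_in A)) A.

Definition adjacent A B : bool := [exists x in A, exists y in B, x -- y].

Definition neighbours (x : G) : {set G} := [set y | x -- y].

Definition max_degree : nat := \max_(x : G) #|neighbours x|.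

Definition is_tree : Prop :=
  [/\ 0 < #|G|, connected_set [set: G]
    & forall c : seq G, 2 < size c -> ~ ucycle (@edge G) c].

(* G is a path (with at least one vertex): its vertices can be listed so that
   the edges of G are exactly the pairs of consecutive vertices. *)
Definition is_path : Prop :=
  exists s : seq G,
    [/\ 0 < size s, uniq s, forall x, x \in s
      & forall x y, x -- y = (index y s == (index x s).+1)
                          || (index x s == (index y s).+1)].

Definition bandwidth_le (k : nat) : Prop :=
  exists f : G -> 'I_#|G|,
    bijective f /\ forall x y, x -- y -> f x - f y <= k /\ f y - f x <= k.

Definition clustered_2colourable (c : nat) : Prop :=
  exists f : G -> bool,
    forall b, forall C, C \in components [set x | f x == b] -> #|C| <= c.

End Basic.

(* The colouring is given by the set of red vertices. The blue subgraph is the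
   one induced by the remaining vertices; it is the disjoint union of its
   components, each of which has to be a path. *)
Definition red_blue_paths (G : sgraph) (r p : nat) : Prop :=
  exists red : {set G},
    [/\ #|red| <= r, #|components (~: red)| <= p
      & forall C, C \in components (~: red) -> is_path (induced C)].

Definition minor (H G : sgraph) : Prop :=
  exists B : H -> {set G},
    [/\ forall x, B x != set0 /\ connected_set (B x),
        forall x y, x != y -> [disjoint B x & B y]
      & forall x y, x -- y -> adjacent (B x) (B y)].

Definition decomposition (G T : sgraph) (B : T -> {set G}) : Prop :=
  [/\ forall x : G, exists j, x \in B j,
      forall x y : G, x -- y -> exists j, x \in B j /\ y \in B j
    & forall x : G, connected_set [set j | x \in B j]].

Definition decomposition_width (G T : sgraph) (B : T -> {set G}) : nat :=
  (\max_(j : T) #|B j|).-1.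

Definition treewidth_le (G : sgraph) (k : nat) : Prop :=
  exists (T : sgraph) (B : T -> {set G}),
    [/\ is_tree T, decomposition B & decomposition_width B <= k].

Definition pathwidth_le (G : sgraph) (k : nat) : Prop :=
  exists (T : sgraph) (B : T -> {set G}),
    [/\ is_path T, decomposition B & decomposition_width B <= k].

(* An induced subgraph H_i is represented by its vertex set. A sequence
   H_1, ..., H_l is indexed from 0, so that [upto H i] is the union of the
   sets H j with j <= i. *)
Section Partition.
Variables (G : sgraph) (l : nat) (H : 'I_l -> {set G}).

Definition upto (i : 'I_l) : {set G} := \bigcup_(j < l | j <= i) H j.

Definition adjacent_parts (i : 'I_l) (C : {set G}) : {set 'I_l} :=
  [set j : 'I_l | (j <= i) && adjacent C (H j)].

Definition connected_partition : Prop :=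
  [/\ forall i, H i != set0 /\ connected_set (H i),
      forall i j, i != j -> [disjoint H i & H j]
    & \bigcup_i H i = [set: G]].

(* The condition ranges over all proper prefixes of the sequence. *)
Definition partition_width (k : nat) : Prop :=
  forall i : 'I_l, i.+1 < l ->
  forall C, C \in components (~: upto i) -> #|adjacent_parts i C| <= k.

End Partition.

(* Main.v *)
(* The parts are chosen greedily. Given the parts so far and a component C of
   the rest, pick in C one terminal next to each part adjacent to C and let the
   next part be a smallest connected subset H of C containing these terminals.
   Then H is adjacent to all parts adjacent to C, so the parts adjacent to a
   remaining component are pairwise adjacent; t - 1 of them, together with the
   component, would form a K_t-minor, so there are at most k = t - 2.

   In a spanning tree of H all leaves other than the root are terminals, so an
   antichain of non-root vertices has at most k elements, and at most k - 1 if
   the root is a terminal. With a breadth-first tree rooted at v the neighbours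
   of v are an antichain, which bounds the degree. In a breadth-first ordering
   from a terminal, the vertices after x up to y, for an edge xy, are an
   antichain, which bounds the bandwidth. Applied to H + v for v outside H, the
   tree argument gives at most k + 1 neighbours in H, as at most one branch at v
   has no terminal; this suffices unless t = 4, where a third neighbour of v
   would give a K_4-minor. *)
Require Import Defs.
From mathcomp Require Import all_boot.
From mathcomp Require Import zify.

Set Implicit Arguments.
Unset Strict Implicit.
Unset Printing Implicit Defensive.

(** * Connectivity, components and breadth-first trees *)

Lemma connect_homo (T T' : finType) (e : rel T) (e' : rel T') (f : T -> T') :
  (forall x y, e x y -> connect e' (f x) (f y)) ->
  forall x y, connect e x y -> connect e' (f x) (f y).
Proof.
move=> fe x y /connectP[p]; elim: p x => [|z p IH] x /=; first by move=> _ ->.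
move=> /andP[xz pz] eq_y; apply: connect_trans (fe _ _ xz) _.
exact: IH pz eq_y.
Qed.

(** Induction along the walk: no step leaves [C], so each one is also an [e']-step. *)
Lemma connect_closed (T : finType) (e e' : rel T) (C : {pred T}) :
  (forall x y, x \in C -> e x y -> y \in C /\ e' x y) ->
  forall x y, x \in C -> connect e x y -> y \in C /\ connect e' x y.
Proof.
move=> clC x y xC /connectP[p]; elim: p x xC => [|z p IH] x xC /=.
  by move=> _ ->.
move=> /andP[/(clC _ _ xC)[zC xz] pz] /(IH _ zC pz)[yC zy].
by split=> //; apply: connect_trans (connect1 xz) zy.
Qed.

Lemma edge_inE (G : sgraph) (A : {set G}) (x y : G) :
  edge_in A x y = [&& x \in A, y \in A & x -- y].
Proof. by []. Qed.

Lemma edge_in_sym (G : sgraph) (A : {set G}) : symmetric (edge_in A).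
Proof. by move=> x y; rewrite !edge_inE edge_sym andbCA. Qed.

Lemma connect_edge_in_sym (G : sgraph) (A : {set G}) :
  connect_sym (edge_in A).
Proof. exact/sym_connect_sym/edge_in_sym. Qed.

Lemma connect_edge_in_sub (G : sgraph) (A B : {set G}) (x y : G) :
  A \subset B -> connect (edge_in A) x y -> connect (edge_in B) x y.
Proof.
move=> sAB; apply: (@connect_homo _ _ _ _ id) => {}x {}y /and3P[xA yA xy].
by apply: connect1; rewrite edge_inE !(subsetP sAB).
Qed.

Lemma connected_setP (G : sgraph) (A : {set G}) :
  reflect (connected_set A)
    [forall x in A, forall y in A, connect (edge_in A) x y].
Proof.
apply: (iffP idP) => [/forall_inP H x y xA yA | H].
  by move/forall_inP: (H x xA) => /(_ y yA).
by apply/forall_inP => x xA; apply/forall_inP => y yA; apply: H.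
Qed.

Lemma connected_set1 (G : sgraph) (x : G) : connected_set [set x].
Proof. by move=> y z /set1P-> /set1P->. Qed.

(** Allowing [x = y] covers both ways of gluing: at a common vertex and along an edge. *)
Lemma connected_setU (G : sgraph) (A B : {set G}) (x y : G) :
  connected_set A -> connected_set B -> x \in A -> y \in B ->
  (x == y) || (x -- y) -> connected_set (A :|: B).
Proof.
move=> cA cB xA yB xy.
have cxy : connect (edge_in (A :|: B)) x y.
  case/orP: xy => [/eqP-> //|xy]; apply: connect1.
  by rewrite edge_inE !inE xA yB xy orbT.
have toA u : u \in A -> connect (edge_in (A :|: B)) u x.
  by move=> uA; apply: connect_edge_in_sub (cA u x uA xA); apply: subsetUl.
have toB u : u \in B -> connect (edge_in (A :|: B)) u x.
  move=> uB; rewrite connect_edge_in_sym; apply: connect_trans cxy _.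
  by apply: connect_edge_in_sub (cB y u yB uB); apply: subsetUr.
move=> u w; rewrite !inE => uAB wAB; apply: (@connect_trans _ _ x).
  by case/orP: uAB; [apply: toA | apply: toB].
by rewrite connect_edge_in_sym; case/orP: wAB; [apply: toA | apply: toB].
Qed.

(** Without such an edge, walks in [X] from [r] would stay in [Y]. *)
Lemma connected_set_crossing (G : sgraph) (X Y : {set G}) (r : G) :
  connected_set X -> r \in X -> r \in Y -> ~~ (X \subset Y) ->
  exists x y, [/\ x \in X, x \in Y, y \in X, y \notin Y & x -- y].
Proof.
move=> cX rX rY /subsetPn[z zX zY].
case: (boolP [exists x in X, exists y in X,
               [&& x \in Y, y \notin Y & x -- y]]).
  case/exists_inP=> x xX /exists_inP[y yX /and3P[xY yY xy]].
  by exists x, y.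
move=> /exists_inPn noedge.
have [] := @connect_closed _ (edge_in X) (edge_in X) Y _ r z rY (cX r z rX zX).
  move=> x y xY exy; split=> //; case/and3P: exy => xX yX xy.
  have /exists_inPn/(_ y yX) := noedge x xX.
  by rewrite xY xy andbT negbK.
by rewrite (negbTE zY).
Qed.

(** Iterating [p] strictly decreases [d], hence ends at the root [r]. *)
Lemma connected_by_rank (G : sgraph) (X : {set G}) (r : G) (p : G -> G)
    (d : G -> nat) :
  r \in X ->
  {in X, forall x, x != r -> [/\ p x \in X, x -- p x & d (p x) < d x]} ->
  connected_set X.
Proof.
move=> rX parent.
have toR n x : d x < n -> x \in X -> connect (edge_in X) x r.
  elim: n x => // n IH x dx xX; have [->//|xr] := eqVneq x r.
  have [pX xp dp] := parent x xX xr.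
  apply: connect_trans (connect1 _) (IH (p x) _ pX); last by lia.
  by rewrite edge_inE xX pX.
move=> x y xX yX; apply: (@connect_trans _ _ r); first exact: toR (ltnSn _) xX.
by rewrite connect_edge_in_sym; apply: toR (ltnSn _) yX.
Qed.

(** The last clause expresses maximality: a component is closed under edges inside [A]. *)
Lemma componentsP (G : sgraph) (A C : {set G}) :
  C \in components A ->
  [/\ C \subset A, C != set0, connected_set C
    & forall x y, x \in C -> y \in A -> x -- y -> y \in C].
Proof.
case/imsetP=> x xA eqC.
have CE y : (y \in C) = (y \in A) && connect (edge_in A) x y by rewrite eqC inE.
have clC y z : y \in C -> edge_in A y z -> z \in C /\ edge_in C y z.
  rewrite CE => /andP[yA xy] yz; have /and3P[_ zA yz'] := yz.
  have zC : z \in C by rewrite CE zA (connect_trans xy (connect1 yz)).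
  by split=> //; rewrite edge_inE zC yz' CE yA xy.
have xC : x \in C by rewrite CE xA connect0.
split; first by apply/subsetP=> y; rewrite CE => /andP[].
- by apply/set0Pn; exists x.
- have fromx y : y \in C -> connect (edge_in C) x y.
    by rewrite CE => /andP[yA /(connect_closed clC xC)[]].
  move=> y z yC zC; apply: (@connect_trans _ _ x); last exact: fromx.
  by rewrite connect_edge_in_sym fromx.
move=> y z yC zA yz; have yA : y \in A by move: yC; rewrite CE => /andP[].
by case: (clC y z yC) => //; rewrite edge_inE yA zA.
Qed.

Lemma component_sup (G : sgraph) (A X : {set G}) (x : G) :
  connected_set X -> X \subset A -> x \in X ->
  exists C, [/\ C \in components A, X \subset C & x \in C].
Proof.
move=> cX sXA xX; have xA := subsetP sXA x xX.
exists [set y in A | connect (edge_in A) x y]; split.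
- exact: imset_f.
- apply/subsetP=> y yX; rewrite inE (subsetP sXA) //=.
  exact: connect_edge_in_sub sXA (cX x y xX yX).
by rewrite inE xA connect0.
Qed.

Lemma components_meet (G : sgraph) (A C X : {set G}) (x : G) :
  C \in components A -> connected_set X -> X \subset A ->
  x \in C -> x \in X -> X \subset C.
Proof.
move=> /componentsP[_ _ _ clC] cX sXA xC xX; apply/subsetP=> y yX.
case: (@connect_closed _ (edge_in X) (edge_in X) C _ x y xC (cX x y xX yX)) => //.
move=> u w uC uw; split=> //; have /and3P[uX wX uw'] := uw.
exact: clC uC (subsetP sXA w wX) uw'.
Qed.

Lemma adjacentP (G : sgraph) (A B : {set G}) :
  reflect (exists x y, [/\ x \in A, y \in B & x -- y]) (adjacent A B).
Proof.
apply: (iffP exists_inP) => [[x xA /exists_inP[y yB xy]]|[x [y [xA yB xy]]]].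
  by exists x, y.
by exists x => //; apply/exists_inP; exists y.
Qed.

Lemma adjacent_sym (G : sgraph) (A B : {set G}) : adjacent A B = adjacent B A.
Proof.
by apply/adjacentP/adjacentP => -[x [y [xA yB xy]]]; exists y, x;
  rewrite edge_sym.
Qed.

Lemma adjacentS (G : sgraph) (A A' B B' : {set G}) :
  A \subset A' -> B \subset B' -> adjacent A B -> adjacent A' B'.
Proof.
move=> sA sB /adjacentP[x [y [xA yB xy]]]; apply/adjacentP; exists x, y.
by rewrite (subsetP sA) ?(subsetP sB).
Qed.

(* [p] is a parent function of a tree with root [r] on [X] in which every
   vertex of [A] lies below level [m] and its parent does not; branches at
   vertices of [A] without terminal are cut off. *)
Lemma prune_tree (G : sgraph) (X S A : {set G}) (r : G) (p : G -> G)
    (d : G -> nat) (m : nat) :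
  r \in X -> p r = r -> S \subset X -> A \subset X ->
  {in X, forall x, x != r -> [/\ p x \in X, x -- p x & d (p x) < d x]} ->
  {in A, forall a, d (p a) <= m < d a} ->
  exists X' : {set G}, [/\ X' \subset X, S \subset X', connected_set X'
    & #|A| + #|X'| <= #|X| + #|S :\ r|].
Proof.
move=> rX pr SX AX parent level.
have rA : r \notin A by apply/negP => /level; rewrite pr; lia.
have pX x : x \in X -> p x \in X /\ d (p x) <= d x.
  by move=> xX; have [->|/(parent x xX)[? _ /ltnW]] := eqVneq x r;
    rewrite ?pr.
have itX n x : x \in X -> iter n p x \in X /\ d (iter n p x) <= d x.
  move=> xX; elim: n => //= n [IH1 IH2]; have [H1 H2] := pX _ IH1.
  by split=> //; apply: leq_trans H2 IH2.
have rroot a : fconnect p r a -> a = r.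
  by move=> /iter_findex <-; elim: (findex _ _ _) => //= n ->.
(* A parent path meets [A] at most once: past an element of [A] all vertices have [d] at most
   [m]. *)
have chain s a b i j : s \in X -> a \in A -> b \in A ->
    iter i p s = a -> iter j p s = b -> i < j -> False.
  move=> sX aA bA eqa eqb ij; have aX := subsetP AX a aA.
  have eqb' : b = iter (j - i).-1 p (p a).
    rewrite -eqb -eqa -iterSr -iterD; congr (iter _ _ _); lia.
  have [_ lb] := itX (j - i).-1 (p a) (proj1 (pX a aX)).
  have := level a aA; have := level b bA; rewrite {2}eqb'; lia.
(* The members of [A] whose branch has no terminal; [X'] is what remains when these branches are
   removed. *)
pose Z := [set a in A | [forall s in S, ~~ fconnect p s a]].
pose X' := X :\: [set x | [exists a in Z, fconnect p x a]].
exists X'; split; first exact: subsetDl.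
- apply/subsetP=> s sS; rewrite !inE (subsetP SX) // andbT.
  apply/exists_inPn => a; rewrite inE => /andP[_ /forall_inP]; exact.
- apply: (@connected_by_rank _ _ r p d).
    rewrite !inE rX andbT; apply/exists_inPn=> a.
    rewrite inE => /andP[aA _]; apply/negP=> /rroot eqa.
    by rewrite -eqa aA in rA.
  move=> x; rewrite inE => /andP[xZ xX] xr; have [pxX xp dp] := parent x xX xr.
  split=> //; rewrite inE pxX andbT; apply: contra xZ; rewrite !inE.
  case/exists_inP=> a aZ pa; apply/exists_inP; exists a => //.
  exact: connect_trans (fconnect1 p x) pa.
have ZX' : #|Z| + #|X'| <= #|X|.
  have dis : [disjoint Z & X'].
    rewrite disjoint_subset; apply/subsetP=> a aZ; rewrite !inE negb_and negbK.
    by apply/orP; left; apply/exists_inP; exists a.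
  move: (leq_card_setU Z X'); rewrite dis => -[_ /eqP <-].
  apply: subset_leq_card; rewrite subUset subsetDl andbT.
  by apply: subset_trans AX; apply/subsetP=> a; rewrite inE => /andP[].
(* Every other member of [A] is charged to a terminal in its branch. By [chain] no terminal is
   charged twice, and the root is never charged. *)
pose f a := odflt r [pick s in S | fconnect p s a].
have fP a : a \in A :\: Z -> [/\ f a \in S, fconnect p (f a) a & a \in A].
  rewrite !inE => /andP[nZ aA]; move: nZ; rewrite aA /= => /forall_inPn[s sS].
  rewrite negbK => sa; rewrite /f; case: pickP => [s' /andP[]//|/(_ s)].
  by rewrite sS sa.
have finj : {in A :\: Z &, injective f}.
  move=> a b /fP[faS fa aA] /fP[fbS fb bA] eqf.
  rewrite -eqf in fb; have sX := subsetP SX _ faS.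
  have [ij|ij|eq_ij] := ltngtP (findex p (f a) a) (findex p (f a) b).
  - by case: (chain _ a b _ _ sX aA bA _ _ ij); rewrite iter_findex.
  - by case: (chain _ b a _ _ sX bA aA _ _ ij); rewrite iter_findex.
  by rewrite -(iter_findex fa) eq_ij iter_findex.
have : #|A :\: Z| <= #|S :\ r|.
  rewrite -(card_in_imset finj); apply: subset_leq_card.
  apply/subsetP=> _ /imsetP[a /fP[faS fa aA] ->]; rewrite !inE faS andbT.
  apply/eqP=> far; rewrite far in fa.
  by rewrite -(rroot _ fa) aA in rA.
have := cardsID Z A; have -> : A :&: Z = Z.
  by apply/setIidPr/subsetP=> a; rewrite inE => /andP[].
lia.
Qed.

(* [d] is a breadth-first numbering and [p x] the first neighbour of [x]. *)
Lemma bfs_order (G : sgraph) (X : {set G}) (r : G) :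
  connected_set X -> r \in X ->
  exists (d : G -> nat) (p : G -> G),
    [/\ [/\ d r = 0, p r = r, {in X &, injective d}
          & {in X, forall x, d x < #|X|}],
        {in X, forall x, x != r -> [/\ p x \in X, x -- p x & d (p x) < d x]},
        {in X &, forall x y, d x <= d y -> d (p x) <= d (p y)}
      & {in X &, forall x y, x -- y -> d (p y) <= d x}].
Proof.
move=> cX rX.
(* The list [s] is the order of discovery and [find (edge x) s] the position of the parent of [x].
   The last two conditions are the queue discipline: parents of listed vertices occur in order, and
   the first listed neighbour of an unlisted vertex is never before the parent of a listed one. *)
pose inv s := [/\ uniq s, {subset s <= X}, index r s = 0 /\ r \in s,
  {in s, forall x, x != r -> find (edge x) s < index x s}
  & {in s &, forall x y, x != r -> y != r -> index x s <= index y s ->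
       find (edge x) s <= find (edge y) s} /\
   forall x y, x \in s -> x != r -> y \in X -> y \notin s ->
       find (edge x) s <= find (edge y) s].
have build n : n < #|X| -> exists2 s, inv s & size s = n.+1.
  elim: n => [_|n IH ltn].
    exists [:: r] => //; split=> //.
    - by move=> x; rewrite inE => /eqP->.
    - by rewrite /= eqxx inE eqxx.
    - by move=> x; rewrite inE => /eqP->; rewrite eqxx.
    by split=> [x y|x y]; rewrite inE => /eqP->; rewrite ?eqxx // => _;
      rewrite eqxx.
  have [|s [us sX [r0 rs] par [mon out]] size_s] := IH; first by lia.
  have [x [y [xX xs yX ys xy]]] : exists x y, 
      [/\ x \in X, x \in s, y \in X, y \notin s & x -- y].
    have [||x [y [xX]]] := @connected_set_crossing _ X [set x in s] r cX rX.
    - by rewrite inE.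
    - by apply/negP=> /subset_leq_card;
        rewrite cardsE (card_uniqP us) size_s leqNgt ltn.
    by rewrite !inE; exists x, y.
  have yC : (y \in X) && (y \notin s) by rewrite yX.
  (* The next vertex is one whose first listed neighbour comes earliest; a vertex without listed
     neighbour gets position [size s] and loses to [y]. *)
  case: (@arg_minnP _ y [pred z | (z \in X) && (z \notin s)]
           (fun z => find (edge z) s) yC) => w /andP[wX ws] wmin.
  have ltw : find (edge w) s < size s.
    apply: leq_ltn_trans (wmin y yC) _; rewrite -has_find; apply/hasP.
    by exists x => //; rewrite edge_sym.
  (* Parent positions are final once a listed neighbour exists, so the old invariants survive. *)
  have find_rcons z : find (edge z) (rcons s w) =
      if has (edge z) s then find (edge z) s else size s + ~~ (z -- w).
    rewrite -cats1 find_cat /=; case: ifP => //; case: (z -- w) => //.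
  have idx z : z \in s -> index z (rcons s w) = index z s.
    by move=> zs; rewrite -cats1 index_cat zs.
  have idxw : index w (rcons s w) = size s.
    by rewrite -cats1 index_cat (negbTE ws) /= eqxx addn0.
  have hass z : z \in s -> z != r -> has (edge z) s.
    move=> zs zr; rewrite has_find.
    by apply: leq_trans (par z zs zr) _; rewrite ltnW // index_mem.
  have hasw : has (edge w) s by rewrite has_find.
  exists (rcons s w); last by rewrite size_rcons size_s.
  split.
  - by rewrite rcons_uniq ws.
  - by move=> z; rewrite mem_rcons inE => /orP[/eqP->|/sX].
  - by rewrite idx // mem_rcons inE rs orbT.
  - move=> z; rewrite mem_rcons inE => /orP[/eqP-> _|zs zr].
      by rewrite find_rcons hasw idxw.
    by rewrite find_rcons hass // idx // par.
  split.
    move=> z z'; rewrite !mem_rcons !inE.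
    case/orP=> [/eqP->|zs]; case/orP=> [/eqP->|z's] zr z'r //.
    - by rewrite idxw idx // leqNgt index_mem z's.
    - by rewrite !find_rcons hass // hasw => _; apply: out.
    by rewrite !find_rcons !hass // !idx //; apply: mon.
  move=> z z' zs zr z'X; rewrite mem_rcons inE negb_or => /andP[z'w z's].
  have z'C : (z' \in X) && (z' \notin s) by rewrite z'X.
  rewrite !find_rcons; move: zs; rewrite mem_rcons inE => /orP[/eqP->|zs].
    rewrite hasw; case: ifP => _; first exact: wmin.
    by apply: leq_trans (ltnW ltw) _; apply: leq_addr.
  rewrite hass //; case: ifP => _; first exact: out.
  apply: leq_trans _ (leq_addr _ _).
  by apply: leq_trans (find_size _ _).
have [|s [us sX [r0 rs] par [mon _]] size_s] := build #|X|.-1.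
  by rewrite prednK //; apply/card_gt0P; exists r.
have {}size_s : size s = #|X|.
  by rewrite size_s prednK //; apply/card_gt0P; exists r.
have sE x : (x \in s) = (x \in X).
  have : [set x in s] == X.
    rewrite eqEcard cardsE (card_uniqP us) size_s leqnn andbT.
    by apply/subsetP=> z; rewrite inE; apply: sX.
  by move/eqP=> <-; rewrite inE.
have hasX x : x \in X -> x != r -> has (edge x) s.
  rewrite -sE => xs xr; rewrite has_find.
  by apply: leq_trans (par x xs xr) _; rewrite ltnW // index_mem.
pose p x := if x == r then r else nth r s (find (edge x) s).
have idxp x : x \in X -> x != r -> index (p x) s = find (edge x) s.
  move=> xX xr; rewrite /p (negbTE xr) index_uniq //.
  by rewrite -has_find hasX.
exists (index^~ s), p; split.
- split=> //; first by rewrite /p eqxx.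
    move=> x y xX yX /= eqi; rewrite -(@nth_index _ r x s) ?sE // eqi.
    by rewrite nth_index ?sE.
  by move=> x xX; rewrite -size_s index_mem sE.
- move=> x xX xr; rewrite idxp // par ?sE //.
  have hx := hasX x xX xr.
  split=> //; rewrite /p (negbTE xr); last exact: nth_find.
  by rewrite -sE mem_nth // -has_find.
- move=> x y xX yX; have [->|xr] := eqVneq x r; first by rewrite /p eqxx r0.
  have [->|yr] := eqVneq y r.
    move=> le; suff: x = r by move/eqP; rewrite (negbTE xr).
    rewrite -(@nth_index _ r x s) ?sE //.
    have -> : index x s = index r s by apply/eqP; rewrite r0 -leqn0 -r0.
    by rewrite nth_index.
  by rewrite !idxp //; apply: mon; rewrite ?sE.
move=> x y xX yX xy; have [->|yr] := eqVneq y r; first by rewrite /p eqxx r0.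
rewrite idxp // leqNgt; apply/negP=> /(before_find r).
by rewrite nth_index ?sE // edge_sym xy.
Qed.

(** * Minimal connected sets: degrees and bandwidth *)

(** As only subsets of [X] compete, the notion depends only on the subgraph induced by [X]. *)
Definition steiner (G : sgraph) (S X : {set G}) : Prop :=
  [/\ S \subset X, connected_set X
    & forall X' : {set G},
        S \subset X' -> X' \subset X -> connected_set X' -> X' = X].

(** In a breadth-first tree rooted at [r] every neighbour of [r] is a child of [r], so pruning
    applies at level 0. *)
Lemma neighbours_prune (G : sgraph) (X S : {set G}) (r : G) :
  connected_set X -> r \in X -> S \subset X ->
  exists X' : {set G}, [/\ X' \subset X, S \subset X', connected_set X'
    & #|neighbours r :&: X| + #|X'| <= #|X| + #|S :\ r|].
Proof.
move=> cX rX SX.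
have [d [p [[dr pr dinj _] parent _ first]]] := bfs_order cX rX.
apply: (@prune_tree _ X S _ r p d 0) => //; first exact: subsetIr.
move=> a; rewrite !inE => /andP[ra aX].
rewrite -{1}dr first //= lt0n; apply/eqP; rewrite -dr => /(dinj _ _ aX rX) eqa.
by rewrite eqa edge_irrefl in ra.
Qed.

(** Minimality rules out proper pruning, so the pruning inequality becomes the degree bound. *)
Lemma steiner_degree (G : sgraph) (S X : {set G}) (v : G) :
  steiner S X -> v \in X -> #|neighbours v :&: X| <= #|S|.
Proof.
move=> [SX cX minX] vX.
have [X' [X'X SX' cX' le]] := neighbours_prune cX vX SX.
rewrite (minX X') // in le; have := subset_leq_card (subD1set S v); lia.
Qed.

(** The tree lives on [v |: X], so competitors may contain [v] and minimality is by size; the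
    additional one in the bound comes from counting [v]. *)
Lemma steiner_neighbours_out (G : sgraph) (S X : {set G}) (v : G) :
  S \subset X -> connected_set X -> v \notin X ->
  (forall X' : {set G}, S \subset X' -> X' \subset v |: X ->
     connected_set X' -> #|X| <= #|X'|) ->
  #|neighbours v :&: X| <= #|S|.+1.
Proof.
move=> SX cX vX minX.
have [->|[u]] := set_0Vmem (neighbours v :&: X); first by rewrite cards0.
rewrite !inE => /andP[vu uX].
have cvX : connected_set (v |: X).
  apply: (@connected_setU _ [set v] X v u) => //; first exact: connected_set1.
    exact: set11.
  by rewrite vu orbT.
have SvX : S \subset v |: X by apply: subset_trans SX (subsetUr _ _).
have [X' [X'X SX' cX' le]] := neighbours_prune cvX (setU11 v X) SvX.
have := minX X' SX' X'X cX'; have := subset_leq_card (subD1set S v).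
have : #|neighbours v :&: X| <= #|neighbours v :&: (v |: X)|.
  by rewrite subset_leq_card // setIS // subsetUr.
move: le; rewrite cardsU1 vX; lia.
Qed.

(** For an edge [x -- y], the parent of any [z] in the interval is numbered at most
    [d (p y) <= d x], by monotonicity and the first-neighbour property. The interval is thus pruned
    at level [d x]. *)
Lemma steiner_bfs (G : sgraph) (S X : {set G}) (r : G) :
  steiner S X -> r \in X ->
  exists (d : G -> nat) (p : G -> G),
    [/\ d r = 0, {in X &, injective d}, {in X, forall x, d x < #|X|},
        {in X &, forall x y, x -- y -> d x <= d y ->
           #|[set z in X | d x < d z <= d y]| <= #|S :\ r|}
      & {in X, forall x, x != r -> [/\ p x \in X, x -- p x & d (p x) < d x]}].
Proof.
move=> [SX cX minX] rX.
have [d [p [[dr pr dinj dlt] parent mono first]]] := bfs_order cX rX.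
exists d, p; split=> // x y xX yX xy dxy.
have [||X' [X'X SX' cX']] :=
  @prune_tree _ X S [set z in X | d x < d z <= d y] r p d (d x) rX pr SX _ parent.
- by apply/subsetP=> z; rewrite inE => /andP[].
- move=> a; rewrite inE => /and3P[aX xa ay]; rewrite xa andbT.
  by apply: leq_trans (mono _ _ aX yX ay) (first _ _ xX yX xy).
by rewrite (minX X') // [X in _ <= X]addnC leq_add2r.
Qed.

(** An injection of [X] into the numbers below [#|X|] is onto, so every number in the interval is
    attained. *)
Lemma card_interval (T : finType) (X : {set T}) (d : T -> nat) (a b : nat) :
  {in X &, injective d} -> {in X, forall x, d x < #|X|} -> b < #|X| ->
  b - a <= #|[set z in X | a < d z <= b]|.
Proof.
move=> dinj dlt bX.
(* The ordinal type has one spare element because [inord] lands in a successor bound. *)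
pose f z : 'I_#|X|.+1 := inord (d z).
have fE z : z \in X -> f z = d z :> nat.
  by move=> zX; rewrite inordK // ltnW // ltnS dlt.
have finj : {in X &, injective f}.
  by move=> x y xX yX /(congr1 val); rewrite /= !fE //; apply: dinj.
have onto c : c < #|X| -> exists2 z, z \in X & d z = c.
  move=> cX; have : inord c \in f @: X.
    suff -> : f @: X = [set i : 'I_#|X|.+1 | i < #|X|].
      by rewrite inE inordK // ltnW.
    apply/eqP; rewrite eqEcard card_in_imset //; apply/andP; split.
      by apply/subsetP=> _ /imsetP[z zX ->]; rewrite inE fE ?dlt.
    rewrite -[X in _ <= X]card_ord.
    apply: leq_trans (leq_imset_card (widen_ord (leqnSn #|X|)) _).
    apply: subset_leq_card; apply/subsetP=> i; rewrite inE => ltiX.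
    apply/imsetP; exists (Ordinal ltiX) => //; exact: val_inj.
  case/imsetP=> z zX eqc; exists z => //.
  by rewrite -fE // -eqc inordK // ltnW.
have [le|lt] := leqP b a; first by rewrite (eqP le).
elim: b lt bX => // b IH lt bX.
have [z zX dz] := onto _ bX; rewrite subSn //.
rewrite (cardsD1 z) inE zX dz lt leqnn /= add1n ltnS.
have -> : [set z0 in X | a < d z0 <= b.+1] :\ z = [set z0 in X | a < d z0 <= b].
  apply/setP=> u; rewrite !inE; case uX: (u \in X); rewrite ?andbF //=.
  have -> : (u != z) = (d u != b.+1).
    by congr (~~ _); apply/eqP/eqP => [->//|]; rewrite -dz; apply: dinj.
  lia.
have [le|ltb] := leqP b a; first by rewrite (eqP le).
by apply: IH => //; apply: ltnW.
Qed.

(** The breadth-first numbering itself is the ordering. Rooting it at a terminal removes that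
    terminal from the count, whence the predecessor. *)
Lemma steiner_bandwidth (G : sgraph) (S : {set G}) :
  steiner S [set: G] -> S != set0 -> bandwidth_le G #|S|.-1.
Proof.
move=> stS /set0Pn[r rS].
have [d [p [_ dinj dlt ordered _]]] := steiner_bfs stS (in_setT r).
have cardT : #|[set: G]| = #|G| by rewrite cardsT.
have dG x : d x < #|G| by rewrite -cardT dlt.
pose f x := Ordinal (dG x).
have finj : injective f.
  by move=> x y /(congr1 val) /= /dinj; apply; rewrite inE.
exists f; split; first by apply: inj_card_bij => //; rewrite card_ord.
have half x y : x -- y -> d y - d x <= #|S|.-1.
  move=> xy; have [dxy|/ltnW/eqP-> //] := leqP (d x) (d y).
  apply: leq_trans (@card_interval _ [set: G] d _ _ dinj dlt _) _;
    first exact: dlt.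
  apply: leq_trans (ordered _ _ _ _ xy dxy) _; rewrite ?inE //.
  by rewrite [X in _ <= X.-1](cardsD1 r) rS.
by move=> x y xy; split; apply: half; rewrite // edge_sym.
Qed.

(** * Path graphs, and decompositions from a vertex ordering *)

Lemma path_graph_sym (n : nat) :
  symmetric [rel i j : 'I_n | (j == i.+1 :> nat) || (i == j.+1 :> nat)].
Proof. by move=> i j /=; rewrite orbC. Qed.

Lemma path_graph_irrefl (n : nat) :
  irreflexive [rel i j : 'I_n | (j == i.+1 :> nat) || (i == j.+1 :> nat)].
Proof. by move=> i /=; apply/negbTE; lia. Qed.

Definition path_graph (n : nat) : sgraph :=
  SGraph (@path_graph_sym n) (@path_graph_irrefl n).

Lemma path_graphE (n : nat) (i j : path_graph n) :
  i -- j = (val j == (val i).+1) || (val i == (val j).+1).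
Proof. by []. Qed.

Lemma is_path_path_graph (n : nat) : 0 < n -> is_path (path_graph n).
Proof.
move=> n0; exists (enum 'I_n); split.
- by rewrite size_enum_ord.
- exact: enum_uniq.
- by move=> x; rewrite mem_enum.
by move=> x y; rewrite !index_enum_ord path_graphE.
Qed.

(** Each vertex below [b] has its successor as parent, and [n - i] decreases on the way to the root
    [b]. *)
Lemma path_graph_interval (n a b : nat) :
  b < n -> connected_set [set i : path_graph n | a <= i <= b].
Proof.
move=> b_lt; have [lt_ba|le_ab] := ltnP b a.
  by move=> x y; rewrite inE; lia.
pose r : path_graph n := Ordinal b_lt.
pose p (i : path_graph n) : path_graph n := insubd r i.+1.
have pE (i : path_graph n) : i < b -> val (p i) = i.+1.
  by move=> ib; rewrite /p val_insubd; case: ifP => //; lia.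
apply: (@connected_by_rank (path_graph n) _ r p (fun i : path_graph n => n - i)).
  by rewrite inE /= le_ab leqnn.
move=> i; rewrite inE => /andP[ai ib] neq.
have ltib : i < b.
  rewrite ltn_neqAle ib andbT; apply: contraNneq neq => eqi.
  by apply/eqP/val_inj.
have pi := pE i ltib; split.
- by rewrite inE [nat_of_ord _]pi; lia.
- by rewrite path_graphE pi eqxx.
by rewrite [nat_of_ord (p i)]pi; lia.
Qed.

(** On a cycle, the two neighbours of the largest vertex would both be its predecessor, hence
    equal. *)
Lemma is_tree_path_graph (n : nat) : 0 < n -> is_tree (path_graph n).
Proof.
move=> n0; split; first by rewrite card_ord.
  have := @path_graph_interval n 0 n.-1; rewrite ltn_predL => /(_ n0).
  congr connected_set; apply/setP=> i; rewrite !inE /=.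
  by rewrite -ltnS prednK ?ltn_ord.
move=> c sizec /andP[cyc uc].
have [m mc maxm] : exists2 m, m \in c & {in c, forall i : path_graph n, i <= m}.
  have [x xc] : exists x, x \in c.
    by case: c sizec {cyc uc} => // x c _; exists x; rewrite inE eqxx.
  by case: (arg_maxnP (fun i : path_graph n => val i) xc) => m mc maxm;
    exists m.
case: (rot_to mc) => i c' eqc.
have : uniq (m :: c') by rewrite -eqc rot_uniq.
have : cycle (@edge (path_graph n)) (m :: c') by rewrite -eqc rot_cycle.
have : 2 < size (m :: c') by rewrite -eqc size_rot.
have : {in m :: c', forall i : path_graph n, i <= m}.
  by move=> j; rewrite -eqc mem_rot; apply: maxm.
case/lastP: c' {eqc} => // c' b; case: c' => // a c' max_m _.
rewrite /= rcons_path last_rcons => /and3P[am _ /= bm] /and3P[_ ab _].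
have := max_m a; have := max_m b; rewrite !inE !mem_rcons !inE !eqxx !orbT.
move=> /(_ isT) ble /(_ isT) ale.
have eq_ab : a = b by apply: val_inj => /=; lia.
by rewrite eq_ab mem_rcons inE eqxx in ab.
Qed.

(** The bag of [j] is the window of [k + 1] positions starting at [j]; an edge lies in the window
    that starts at its earlier end. *)
Lemma bandwidth_decomposition (G : sgraph) (k : nat) :
  bandwidth_le G k ->
  exists B : path_graph #|G| -> {set G},
    decomposition B /\ decomposition_width B <= k.
Proof.
move=> [f [fbij fk]]; have finj := bij_inj fbij.
exists (fun j : path_graph #|G| => [set x | j <= f x <= j + k]); split;
  first split.
- by move=> x; exists (f x); rewrite inE leqnn leq_addr.
- have half x y : x -- y -> f x <= f y -> exists j : path_graph #|G|,
      x \in [set x | j <= f x <= j + k] /\ y \in [set x | j <= f x <= j + k].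
    move=> xy le; exists (f x); rewrite !inE leqnn leq_addr le.
    by case: (fk x y xy); split=> //; lia.
  move=> x y xy; have [le|/ltnW le] := leqP (f x) (f y); first exact: half.
  by have [|j [yj xj]] := half y x _ le; [rewrite edge_sym | exists j].
(* The bags containing [x] have the indices from [f x - k] to [f x], truncated subtraction handling
   the start of the ordering. *)
- move=> x; have := @path_graph_interval #|G| (f x - k) (f x) (ltn_ord _).
  congr connected_set; apply/setP=> j; rewrite !inE; lia.
rewrite /decomposition_width -subn1 leq_subLR; apply/bigmax_leqP=> j _.
rewrite -(card_imset _ finj) add1n.
apply: leq_trans (_ : #|[set i : 'I_#|G| | j <= i <= j + k]| <= _).
  by apply: subset_leq_card; apply/subsetP=> _ /imsetP[x xB ->];
    rewrite inE in xB; rewrite inE.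
rewrite cardE -(size_map val) -(size_iota j k.+1); apply: uniq_leq_size.
  by rewrite map_inj_uniq ?enum_uniq //; apply: val_inj.
move=> _ /mapP[i iB ->]; rewrite mem_enum inE in iB.
by rewrite mem_iota addnS ltnS.
Qed.

Lemma bandwidth_pathwidth (G : sgraph) (k : nat) :
  0 < #|G| -> bandwidth_le G k -> pathwidth_le G k.
Proof.
move=> G0 /bandwidth_decomposition[B [dB wB]].
by exists (path_graph #|G|), B; split=> //; apply: is_path_path_graph.
Qed.

Lemma bandwidth_treewidth (G : sgraph) (k : nat) :
  0 < #|G| -> bandwidth_le G k -> treewidth_le G k.
Proof.
move=> G0 /bandwidth_decomposition[B [dB wB]].
by exists (path_graph #|G|), B; split=> //; apply: is_tree_path_graph.
Qed.

(** * Passage to the induced subgraph *)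

Lemma connected_set_induced (G : sgraph) (X : {set G}) (A : {set induced X}) :
  connected_set A <-> connected_set (val @: A).
Proof.
split=> cA x y.
  move=> /imsetP[x' x'A ->] /imsetP[y' y'A ->].
  apply: (connect_homo (f := val)) (cA x' y' x'A y'A) => {}x {}y /and3P[xA yA xy].
  by apply: connect1; rewrite edge_inE !imset_f.
move=> xA yA; have := cA _ _ (imset_f val xA) (imset_f val yA).
have -> : x = insubd x (val x) by rewrite valKd.
have {2}-> : y = insubd x (val y) by rewrite valKd.
rewrite !insubdK ?(valP x) ?(valP y) //.
apply: connect_homo => {y yA}u w /and3P[/imsetP[u' uA ->] /imsetP[w' wA ->] uw].
by rewrite !valKd; apply: connect1; rewrite edge_inE uA wA.
Qed.

(** Connectedness transfers along [val] in both directions, so minimality does as well. *)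
Lemma steiner_induced (G : sgraph) (S X : {set G}) :
  steiner S X -> exists S' : {set induced X},
    steiner S' [set: induced X] /\ #|S'| = #|S|.
Proof.
move=> [SX cX minX]; exists [set x | val x \in S].
have valS : val @: [set x : induced X | val x \in S] = S.
  apply/setP=> x; apply/imsetP/idP => [[y]|xS]; first by rewrite inE => yS ->.
  by exists (Sub x (subsetP SX x xS)); rewrite ?inE SubK.
have valX : val @: [set: induced X] = X.
  apply/setP=> x; apply/imsetP/idP => [[y _ ->]|xX]; first exact: valP.
  by exists (Sub x xX); rewrite ?inE ?SubK.
split; last by rewrite -[in RHS]valS card_imset //; apply: val_inj.
split; first exact: subsetT.
  by apply/connected_set_induced; rewrite valX.
move=> X' SX' _ /connected_set_induced cX'; apply: (imset_inj val_inj).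
rewrite valX; apply: minX => //; first by rewrite -valS imsetS.
apply/subsetP=> _ /imsetP[x _ ->]; exact: valP.
Qed.

(** * Two-colourings with small clusters *)

(** Collapsing everything outside [X1] to the cut-vertex [y] maps walks in [D] to walks in
    [D :&: X1]. *)
Lemma connected_setI_cut (G : sgraph) (X1 X2 D : {set G}) (y : G) :
  y \in X1 ->
  (forall u w, u \in X1 -> w \in X2 -> u -- w -> u = y \/ w = y) ->
  D \subset X1 :|: X2 -> y \in D -> connected_set D -> connected_set (D :&: X1).
Proof.
move=> y1 noedge sD yD cD.
pose g u := if u \in X1 then u else y.
have gE u w : edge_in D u w -> connect (edge_in (D :&: X1)) (g u) (g w).
  move=> /and3P[uD wD uw]; rewrite /g.
  have in2 z : z \in D -> z \notin X1 -> z \in X2.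
    by move=> zD z1; move: (subsetP sD z zD); rewrite inE (negbTE z1).
  case: ifPn => u1; case: ifPn => w1; last exact: connect0.
  - by apply: connect1; rewrite edge_inE !inE uD wD u1 w1 uw.
  - case: (noedge u w u1 (in2 w wD w1) uw) => eqy;
      first by rewrite eqy connect0.
    by rewrite eqy y1 in w1.
  rewrite edge_sym in uw.
  case: (noedge w u w1 (in2 u uD u1) uw) => eqy; first by rewrite eqy connect0.
  by rewrite eqy y1 in u1.
move=> u w /setIP[uD u1] /setIP[wD w1].
by have := connect_homo gE (cD u w uD wD); rewrite /g u1 w1.
Qed.

(** Removing a non-terminal [y] must separate terminals, since otherwise the component [C] of [x]
    would be a smaller connected set. The sides are [y |: C] and [X :\: C], and [y] becomes a
    terminal of both. *)
Lemma steiner_cut (G : sgraph) (S X : {set G}) (x y : G) :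
  steiner S X -> x \in S -> y \in X -> y \notin S ->
  exists X1 X2 : {set G},
    [/\ [/\ X = X1 :|: X2, y \in X1, y \in X2, x \in X1
          & forall u, u \in X1 -> u \in X2 -> u = y],
        forall u w, u \in X1 -> w \in X2 -> u -- w -> u = y \/ w = y,
        steiner (y |: (S :&: X1)) X1, steiner (y |: (S :&: X2)) X2
      & [/\ 0 < #|S :&: X1|, 0 < #|S :&: X2|
          & #|S :&: X1| + #|S :&: X2| = #|S|]].
Proof.
move=> [SX cX minX] xS yX yS.
have xX := subsetP SX x xS.
have xy : x != y by apply: contraNneq yS => <-.
have xXy : [set x] \subset X :\ y by rewrite sub1set !inE xy.
have [C [CC _ xC]] := component_sup (@connected_set1 G x) xXy (set11 x).
have [CX _ cC clC] := componentsP CC.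
have yC : y \notin C by apply/negP => /(subsetP CX); rewrite !inE eqxx.
have CX' : C \subset X by apply: subset_trans CX (subD1set _ _).
pose X1 := y |: C; pose X2 := X :\: C.
have y1 : y \in X1 by rewrite setU11.
have y2 : y \in X2 by rewrite inE yC yX.
have X12 : X = X1 :|: X2.
  apply/setP=> u; rewrite !inE; case: (u =P y) => [->|_] /=;
    first by rewrite yX.
  by case uC: (u \in C) => //=; rewrite (subsetP CX').
have meet u : u \in X1 -> u \in X2 -> u = y.
  by rewrite !inE => /orP[/eqP->//|->].
have noedge u w : u \in X1 -> w \in X2 -> u -- w -> u = y \/ w = y.
  rewrite !inE => /orP[/eqP->|uC]; first by left.
  move=> /andP[wC wX] uw; right; apply/eqP; apply: contraNT wC => wy.
  by apply: clC uC _ uw; rewrite !inE wy.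
have noedge' u w : u \in X2 -> w \in X1 -> u -- w -> u = y \/ w = y.
  by move=> u2 w1 uw; rewrite edge_sym in uw; case: (noedge w u w1 u2 uw); auto.
have c1 : connected_set X1.
  have -> : X1 = X :&: X1 by rewrite X12 setUK.
  by apply: (connected_setI_cut y1 noedge); rewrite -?X12.
have c2 : connected_set X2.
  have -> : X2 = X :&: X2 by rewrite X12 setIC setKU // setUC setUK.
  by apply: (connected_setI_cut y2 noedge'); rewrite 1?setUC -?X12.
(* A connected [A'] inside [A] glued to [B] at [y] contains [S], so it gives all of [X]; as [B]
   meets [A] only in [y], this forces [A' = A]. *)
have minor1 (A B : {set G}) : A :|: B = X -> y \in A -> y \in B ->
    (forall u, u \in A -> u \in B -> u = y) -> connected_set B ->
    connected_set A -> steiner (y |: (S :&: A)) A.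
  move=> AB yA yB mAB cB cA; split=> //.
    by rewrite subUset sub1set yA subsetIr.
  move=> A'; rewrite subUset sub1set => /andP[yA' SA'] A'A cA'.
  have eqX : A' :|: B = X.
    apply: minX; last by apply: (connected_setU cA' cB yA' yB); rewrite eqxx.
      apply/subsetP=> s sS; have := subsetP SX s sS; rewrite -AB !inE.
      by case/orP=> [sA|->]; rewrite ?orbT // (subsetP SA') // inE sS.
    by rewrite -AB setSU.
  apply/eqP; rewrite eqEsubset A'A; apply/subsetP=> u uA.
  have : u \in A' :|: B by rewrite eqX -AB inE uA.
  by rewrite inE => /orP[//|uB]; rewrite (mAB u).
exists X1, X2; split=> //.
- split=> //; by rewrite !inE xC orbT.
- exact: minor1 (esym X12) y1 y2 meet c2 c1.
- by apply: minor1 y2 y1 _ c1 c2; [rewrite setUC | move=> u u2 u1; apply: meet].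
have eqS : #|S :&: X1| + #|S :&: X2| = #|S|.
  have SE : S :&: X1 :|: S :&: X2 = S by rewrite -setIUr -X12; apply/setIidPl.
  rewrite -[in RHS]SE cardsU; have -> : S :&: X1 :&: (S :&: X2) = set0.
    apply/setP=> u; rewrite !inE; apply/negP.
    move=> /andP[/andP[uS u1] /andP[_ /andP[uC uX]]].
    by case/orP: u1 => [/eqP eqy|u1];
      [rewrite -eqy uS in yS | rewrite u1 in uC].
  by rewrite cards0 subn0.
split=> //; first by apply/card_gt0P; exists x; rewrite !inE xS xC orbT.
rewrite lt0n; apply/negP=> S2; rewrite (eqP S2) addn0 in eqS.
have S1 : S \subset C.
  have SX1 : S \subset X1.
    by apply/setIidPl/eqP; rewrite eqEcard subsetIl eqS leqnn.
  apply/subsetP=> s sS; have := subsetP SX1 s sS; rewrite !inE.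
  by case/orP=> // /eqP eqy; rewrite -eqy sS in yS.
by rewrite (minX C S1 CX' cC) yX in yC.
Qed.

(** Ranging over all connected monochromatic sets, and not only components, lets the bounds be
    applied to the part of a cluster on either side of a cut. *)
Definition clustered (G : sgraph) (f : G -> bool) (X : {set G}) (x : G)
    (c c' : nat) : Prop :=
  forall (D : {set G}) (b : bool), D \subset X -> connected_set D ->
    {in D, forall z, f z = b} -> #|D| <= c /\ (x \in D -> #|D| <= c').

(* The sharper bound for the cluster of a prescribed terminal [x] is what lets
   the induction glue two colourings at a cut-vertex. *)
Lemma steiner_clustered (G : sgraph) (S X : {set G}) (x : G) :
  steiner S X -> x \in S -> 1 < #|S| ->
  exists f : G -> bool, clustered f X x (uphalf #|S|) #|S|./2.
Proof.
have [n] := ubnP #|X|; elim: n S X x => // n IH S X x ltn stSX xS S2.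
have [SX cX minX] := stSX.
have [XS|/subsetPn[y yX yS]] := boolP (X \subset S).
  have XE : X = S by apply/eqP; rewrite eqEsubset XS.
  (* If all vertices are terminals, the smaller half including [x] gets one colour and the rest the
     other. *)
  pose A := x |: [set z in take #|S|./2.-1 (enum (S :\ x))].
  have xA : x \in A by rewrite setU11.
  have cardS : #|S :\ x| = #|S|.-1 by rewrite (cardsD1 x S) xS.
  have cardA : #|A| = #|S|./2.
    rewrite cardsU1 inE; have -> : x \notin take #|S|./2.-1 (enum (S :\ x)).
      by apply/negP=> /mem_take; rewrite mem_enum !inE eqxx.
    rewrite cardsE;
      have /card_uniqP -> : uniq (take #|S|./2.-1 (enum (S :\ x))).
      exact/take_uniq/enum_uniq.
    by rewrite size_take -cardE cardS; case: ltnP; lia.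
  have AS : A \subset S.
    rewrite subUset sub1set xS; apply/subsetP=> z; rewrite inE => /mem_take.
    by rewrite mem_enum !inE => /andP[].
  exists (fun z => z \in A) => D [] DX _ mono.
    have : #|D| <= #|A| by apply/subset_leq_card/subsetP=> z /mono ->.
    by rewrite cardA => le; split=> //; move: le; lia.
  split; last by move=> /mono; rewrite xA.
  have : #|D| <= #|S :\: A|.
    by apply/subset_leq_card/subsetP=> z zD;
      rewrite inE mono // -XE (subsetP DX).
  rewrite cardsD (setIidPr AS) cardA; lia.
have [X1 [X2 [[X12 y1 y2 x1 meet] noedge st1 st2 [k1 k2 k12]]]] :=
  steiner_cut stSX xS yX yS.
have cardy A : #|y |: (S :&: A)| = #|S :&: A|.+1.
  by rewrite cardsU1 inE (negbTE yS).
have lt1 : #|X1| < n.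
  have [z] := card_gt0P k2; rewrite inE => /andP[zS z2].
  have : #|X1| < #|X|.
    apply/proper_card/properP; split; first by rewrite X12 subsetUl.
    exists z; first by rewrite X12 inE z2 orbT.
    by apply: contra yS => z1; rewrite -(meet z z1 z2).
  by move/leq_trans; apply.
have lt2 : #|X2| < n.
  have : #|X2| < #|X|.
    apply/proper_card/properP; split; first by rewrite X12 subsetUr.
    exists x; first exact: subsetP SX x xS.
    by apply: contra yS => x2; rewrite -(meet x x1 x2).
  by move/leq_trans; apply.
have yS1 : y \in y |: (S :&: X1) by rewrite setU11.
have yS2 : y \in y |: (S :&: X2) by rewrite setU11.
have [f2 cl2] : exists f : G -> bool,
    clustered f X2 y (uphalf #|S :&: X2|.+1) (#|S :&: X2|.+1)./2.
  by rewrite -cardy; apply: IH => //; rewrite cardy ltnS.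
(* If [X2] has one terminal, the cluster of [y] there is [y] alone, so the sharper bound in [X1] is
   kept for [x]. Otherwise the weaker bound in [X1] is already at most [#|S|./2], and the sharper
   one goes to [y], where clusters merge. *)
pose x' := if #|S :&: X2| == 1 then x else y.
have [f1 cl1] : exists f : G -> bool,
    clustered f X1 x' (uphalf #|S :&: X1|.+1) (#|S :&: X1|.+1)./2.
  rewrite -cardy; apply: IH => //; last by rewrite cardy ltnS.
  by rewrite /x'; case: ifP => // _; rewrite !inE xS x1 orbT.
(* The second colouring is swapped if necessary so that both agree at [y]. *)
exists (fun z => if z \in X1 then f1 z else f2 z (+) f2 y (+) f1 y).
move=> D b DX cD mono.
have mono1 : {in D :&: X1, forall z, f1 z = b}.
  by move=> z /setIP[zD z1]; rewrite -(mono z zD) z1.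
have mono2 : {in D :&: X2, forall z, f2 z = b (+) f2 y (+) f1 y}.
  move=> z /setIP[zD z2]; rewrite -(mono z zD); case: ifP => [z1|_].
    by rewrite (meet z z1 z2); case: (f1 y); case: (f2 y).
  by case: (f2 z); case: (f1 y); case: (f2 y).
have bound1 := cl1 (D :&: X1) b (subsetIr _ _) _ mono1.
have bound2 := cl2 (D :&: X2) _ (subsetIr _ _) _ mono2.
have xX2 : x \notin X2 by apply: contra yS => x2; rewrite -(meet x x1 x2).
have noedge' u w : u \in X2 -> w \in X1 -> u -- w -> u = y \/ w = y.
  by move=> u2 w1 uw; rewrite edge_sym in uw; case: (noedge w u w1 u2 uw); auto.
have [yD|yD] := boolP (y \in D).
  have [|le1 lex] := bound1.
    by apply: connected_setI_cut y1 noedge _ yD cD; rewrite -X12.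
  have [|_ ley] := bound2.
    by apply: connected_setI_cut y2 noedge' _ yD cD; rewrite setUC -X12.
  rewrite inE yD y2 in ley; have {}ley := ley isT.
  (* The two pieces of [D] share exactly [y]; this saving of one makes their bounds add up to the
     required one. *)
  have eqD : #|D|.+1 = #|D :&: X1| + #|D :&: X2|.
    rewrite -cardsUI -setIUr -X12 (setIidPl DX) -addn1; congr (_ + _).
    rewrite -(cards1 y); apply: eq_card => u; rewrite !inE.
    apply/eqP/idP => [->|/andP[/andP[_ u1] /andP[_ u2]]]; last exact: meet.
    by rewrite yD y1 y2.
  move: lex; rewrite /x'; case: ifP => k2E.
    rewrite inE x1 andbT => lex; split.
      by clear - le1 ley eqD k2E k12; lia.
    by move=> /lex {}lex; clear - lex ley eqD k2E k12; lia.
  rewrite inE yD y1 => /(_ isT) lex.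
  by split=> [|_]; clear - lex ley eqD k1 k2 k2E k12; lia.
have [D1|nD1] := boolP (D \subset X1).
  rewrite (setIidPl D1) in bound1; have [le1 lex] := bound1 cD.
  split; first by clear - le1 k2 k12; lia.
  move: lex; rewrite /x'; case: ifP => k2E.
    by move=> lex /lex {}lex; clear - lex k2E k12; lia.
  by move=> _ _; clear - le1 k1 k2 k2E k12; lia.
have D2 : D \subset X2.
  apply/subsetP=> u uD; move: (subsetP DX u uD); rewrite X12 inE.
  case/orP=> // u1; have [a [c [aD a1 cDD c1 ac]]] :=
    connected_set_crossing cD uD u1 nD1.
  have c2 : c \in X2.
    by move: (subsetP DX c cDD); rewrite X12 inE (negbTE c1).
  by case: (noedge a c a1 c2 ac) => eqy;
    [rewrite -eqy aD in yD | rewrite -eqy cDD in yD].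
rewrite (setIidPl D2) in bound2; have [le2 _] := bound2 cD.
split; first by clear - le2 k1 k12; lia.
by move=> /(subsetP D2); rewrite (negbTE xX2).
Qed.

Lemma steiner_2colourable (G : sgraph) (S : {set G}) :
  steiner S [set: G] -> S != set0 -> clustered_2colourable G (uphalf #|S|).
Proof.
move=> stS /set0Pn[x xS].
have [S2|S1] := ltnP 1 #|S|.
  have [f cl] := steiner_clustered stS xS S2; exists f => b C.
  case/componentsP=> CA _ cC _; have [|//] := cl C b (subsetT _) cC.
  by move=> z /(subsetP CA); rewrite inE => /eqP.
(* A single terminal is already connected, so minimality leaves one vertex. *)
have SE : S = [set x].
  apply/eqP; rewrite eq_sym eqEcard sub1set xS cards1 S1 //.
have [_ _ /(_ S (subxx _) (subsetT _))] := stS.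
rewrite {1 2}SE => /(_ (@connected_set1 G x)) eqT.
exists (fun=> true) => b C _; apply: leq_trans (_ : #|[set: G]| <= _).
  exact/subset_leq_card/subsetT.
by rewrite -eqT SE cards1.
Qed.

(** * Red vertices and blue paths *)

Lemma path_splitn (T : Type) (e : rel T) (x : T) (p : seq T) (i : nat) :
  path e x p -> i <= size p ->
  [/\ path e x (take i p), last x (take i p) = nth x (x :: p) i,
      path e (nth x (x :: p) i) (drop i p)
    & last (nth x (x :: p) i) (drop i p) = last x p].
Proof.
move=> ep ip; have lastE : last x (take i p) = nth x (x :: p) i.
  by case: i ip => [|i] ip;
    rewrite ?take0 // (last_nth x) size_takel //= nth_take.
rewrite -lastE; split=> //; first exact: take_path.
  by move: ep; rewrite -{1}(cat_take_drop i p) cat_path => /andP[].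
by rewrite -{3}(cat_take_drop i p) last_cat.
Qed.

(** An induced path listed from end to end; [x0] is only the default of [nth]. *)
Definition chordless_path (G : sgraph) (x0 : G) (q : seq G) : Prop :=
  [/\ uniq q, sorted (@edge G) q
    & forall i j, i < j < size q -> nth x0 q i -- nth x0 q j -> j = i.+1].

(** The path is a shortest one from [Y] to [u]: a chord, a later vertex in [Y], or a neighbour of
    [Y] beyond the first step would give a shorter one. *)
Lemma geodesic (G : sgraph) (Y : {set G}) (u : G) :
  connected_set [set: G] -> Y != set0 ->
  exists (y : G) (p : seq G),
    [/\ y \in Y, last y p = u, chordless_path y (y :: p),
        {in p, forall z, z \notin Y}
      & {in behead p, forall z, ~~ adjacent Y [set z]}].
Proof.
move=> cG /set0Pn[y0 y0Y].
(* Tuples make the existence of a path with [n] steps decidable, so that a least [n] can be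
   taken. *)
pose reach n := [exists y in Y, exists p : n.-tuple G,
                   path (@edge G) y p && (last y p == u)].
have exn : exists n, reach n.
  have /connectP[p ep eq_u] := cG y0 u (in_setT _) (in_setT _).
  exists (size p); apply/exists_inP; exists y0 => //.
  apply/existsP; exists (in_tuple p); rewrite /= eq_u eqxx andbT.
  by apply: sub_path ep => a b /and3P[].
case: (ex_minnP exn) => n /exists_inP[y yY /existsP[[p0 /= size_p0]]].
move=> /andP[ep0 /eqP lp0] minn.
have min_p y' p' : y' \in Y -> path (@edge G) y' p' -> last y' p' = u -> n <= size p'.
  move=> y'Y ep' lp'; apply: minn; apply/exists_inP; exists y' => //.
  by apply/existsP; exists (in_tuple p'); rewrite /= ep' lp' eqxx.
have : size p0 = n by apply/eqP.
case/shortenP: ep0 lp0 => p ep up sub lp size_p0E.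
have le_p : size p <= n.
  rewrite -size_p0E; apply: uniq_leq_size => //; by move: up => /= /andP[].
have size_p : size p = n by apply/eqP; rewrite eqn_leq le_p (min_p y).
exists y, p; split=> //.
- split=> // i j /andP[ij jp] eij; apply/eqP; rewrite /= ltnS in jp.
  rewrite eqn_leq ij andbT leqNgt; apply/negP=> ltij.
  have ip : i <= size p by apply: leq_trans (ltnW ij) jp.
  have [et lt _ _] := path_splitn ep ip.
  have [_ _ ed ld] := path_splitn ep jp.
  have j0 : j.-1.+1 = j by apply: prednK; apply: leq_ltn_trans ij.
  have dropE : drop j.-1 p = nth y (y :: p) j :: drop j p.
    by case: (j) j0 jp => //= j1 _ jp1; rewrite (drop_nth y).
  (* The chord replaces the stretch between positions [i] and [j] of [y :: p]; position [j] there is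
     position [j.-1] of [p]. *)
  have := min_p y (take i p ++ drop j.-1 p) yY.
  rewrite cat_path et lt dropE /= eij ed last_cat /= ld => /(_ isT lp).
  rewrite size_cat /= size_takel // size_drop; rewrite size_p in jp ip *;
    clear - ltij jp ip; lia.
- move=> z /(nthP y)[i ip <-]; apply/negP=> zY.
  have [_ _ ed ld] := path_splitn ep ip; rewrite lp in ld.
  have := min_p _ _ zY ed ld; rewrite size_drop size_p; rewrite size_p in ip;
    clear - ip; lia.
move=> z /(nthP y)[i]; rewrite size_behead nth_behead => ip <-.
apply/negP=> /adjacentP[y' [z' [y'Y /set1P-> yz]]].
have ip2 : i.+2 <= size p by move: ip; case: (size p).
have [_ _ ed ld] := path_splitn ep ip2; rewrite lp in ld.
have := min_p y' (nth y p i.+1 :: drop i.+2 p) y'Y; rewrite /= yz ed.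
by move=> /(_ isT ld); rewrite /= size_drop size_p; rewrite size_p in ip2;
  clear - ip2; lia.
Qed.

Lemma chordless_path_drop (G : sgraph) (x0 : G) (q : seq G) (n : nat) :
  chordless_path x0 q -> chordless_path x0 (drop n q).
Proof.
move=> [uq eq cq]; split; [exact: drop_uniq | exact: drop_sorted |].
move=> i j; rewrite size_drop !nth_drop => ij /cq; lia.
Qed.

Lemma connected_set_path (G : sgraph) (q : seq G) :
  sorted (@edge G) q -> connected_set [set x in q].
Proof.
elim: q => [_ x y|x q IH]; first by rewrite inE.
case: q IH => [_ _|y q IH].
  have -> : [set z in [:: x]] = [set x] by apply/setP=> z; rewrite !inE.
  exact: connected_set1.
move=> /= /andP[xy /IH cq].
have -> : [set z in x :: y :: q] = [set x] :|: [set z in y :: q].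
  by apply/setP=> z; rewrite !inE.
apply: (@connected_setU _ _ _ x y) => //; first exact: connected_set1.
- exact: set11.
- by rewrite !inE eqxx.
by rewrite xy orbT.
Qed.

Lemma is_path_chordless (G : sgraph) (x0 : G) (q : seq G) :
  chordless_path x0 q -> 0 < size q -> is_path (induced [set x in q]).
Proof.
move=> [uq eq cq] q0; pose s : seq (induced [set x in q]) := pmap insub q.
have valsE : map val s = q.
  rewrite /s (pmap_filter (insubK _)); apply/all_filterP/allP => z zq /=.
  by rewrite isSome_insub inE.
exists s; split.
- by rewrite -(size_map val) valsE.
- by rewrite -(map_inj_uniq val_inj) valsE.
- by move=> x; rewrite -(mem_map val_inj) valsE; have := valP x; rewrite inE.
move=> x y; rewrite -!(index_map val_inj) valsE.
have xq : val x \in q by have := valP x; rewrite inE.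
have yq : val y \in q by have := valP y; rewrite inE.
rewrite -[x -- y]/(val x -- val y); move: (val x) (val y) xq yq => a b aq bq.
have half c d : c \in q -> d \in q -> c -- d -> index c q < index d q ->
    index d q = (index c q).+1.
  move=> cin din cd lt; apply: cq; last by rewrite !nth_index.
  by rewrite lt index_mem.
have cons c d : c \in q -> d \in q -> index d q = (index c q).+1 -> c -- d.
  move=> cin din eqi; move/(sortedP x0): eq => /(_ (index c q)).
  by rewrite -eqi !nth_index // index_mem; apply.
apply/idP/orP => [ab|[]/eqP]; last first.
- by rewrite edge_sym; apply: cons.
- exact: cons.
case: (ltngtP (index a q) (index b q)) => lt.
- by left; apply/eqP/half.
- by right; apply/eqP/half; rewrite // edge_sym.
by move: ab; rewrite -(nth_index x0 aq) lt nth_index // edge_irrefl.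
Qed.

(** With connectedness, the second clause makes each listed path a whole component of [B]. *)
Definition linear_forest (G : sgraph) (ps : seq {set G}) (B : {set G}) : Prop :=
  [/\ {in ps, forall P : {set G}, is_path (induced P) /\ connected_set P},
      {in ps, forall (P : {set G}) x y, x \in P -> y \in B -> x -- y -> y \in P}
    & forall x, x \in B <-> exists2 P : {set G}, P \in ps & x \in P].

(** A component meeting a listed path contains it by maximality, and cannot extend beyond it, as no
    edge of [B] leaves the path. *)
Lemma linear_forest_components (G : sgraph) (ps : seq {set G}) (B C : {set G}) :
  linear_forest ps B -> C \in components B -> C \in ps.
Proof.
move=> [pathP closedP memB] CC;
  have [CB /set0Pn[x xC] cC clC] := componentsP CC.
have /memB[P Pps xP] := subsetP CB x xC; have [_ cP] := pathP P Pps.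
have PB : P \subset B by apply/subsetP=> z zP; apply/memB; exists P.
suff -> : C = P by [].
apply/eqP; rewrite eqEsubset (components_meet CC cP PB xC xP) andbT.
apply/negPn/negP=> nCP.
have [a [b [aC aP bC bP ab]]] := connected_set_crossing cC xC xP nCP.
by rewrite (closedP P Pps a b aP (subsetP CB b bC) ab) in bP.
Qed.

(* Each new terminal is joined to the part built so far by a shortest path;
   only its vertex next to that part, which becomes red, has neighbours there. *)
Lemma red_blue_tree (G : sgraph) (a b : G) (l : seq G) :
  connected_set [set: G] ->
  exists (Y R : {set G}) (ps : seq {set G}),
    [/\ [/\ a \in Y, b \in Y, {subset l <= Y} & connected_set Y],
        R \subset Y, #|R| <= size l, size ps <= (size l).+1
      & linear_forest ps (Y :\: R)].
Proof.
move=> cG;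
  elim: l => [|u l [Y [R [ps [[aY bY lY cY] RY cardR size_ps forest]]]]].
  (* The first path, from [a] to [b], is entirely blue. *)
  have [|y [p [ya lp ch _ _]]] := @geodesic G [set a] b cG.
    by apply/set0Pn; exists a; rewrite inE.
  move/set1P: ya => eqy; rewrite eqy {y eqy} in lp ch.
  exists [set x in a :: p], set0, [:: [set x in a :: p]].
  have cp : connected_set [set x in a :: p] by apply: connected_set_path;
    case: ch.
  split=> //; rewrite ?cards0 ?sub0set //.
    by split=> //; rewrite inE ?mem_head // -lp mem_last.
  split.
  - by move=> P; rewrite mem_seq1 => /eqP->; split=> //;
      apply: is_path_chordless ch _.
  - by move=> P; rewrite mem_seq1 => /eqP-> x y _; rewrite setD0.
  move=> x; rewrite setD0; split=> [xp|[P]]; last by rewrite mem_seq1 => /eqP->.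
  by exists [set x in a :: p]; rewrite ?mem_seq1.
have Y0 : Y != set0 by apply/set0Pn; exists a.
(* An empty path means that [u] is already in [Y]. Otherwise [w] turns red and [q], if non-empty, is
   a new blue path. *)
have [y [[|w q] [yY lp ch outY farY]]] := @geodesic G Y u cG Y0.
  exists Y, R, ps; split=> //; [|exact: leqW|exact: leqW].
  by split=> // z; rewrite inE => /orP[/eqP->|/lY//]; rewrite -lp.
have [/= /andP[yp /andP[wq uq]] /andP[yw ewq] _] := ch.
have wY : w \notin Y by apply: outY; rewrite mem_head.
have qY z : z \in q -> z \notin Y by move=> zq; apply: outY;
  rewrite inE zq orbT.
have wR : w \notin R by apply: contra wY; apply: (subsetP RY).
have qR z : z \in q -> z \notin R.
  by move=> /qY; apply: contra; apply: (subsetP RY).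
exists (Y :|: [set z in w :: q]), (w |: R),
  (if q is [::] then ps else [set z in q] :: ps).
have BE : (Y :|: [set z in w :: q]) :\: (w |: R) = (Y :\: R) :|: [set z in q].
  apply/setP=> z; rewrite !inE; have [->|zw] /= := eqVneq z w.
    by rewrite (negbTE wY) (negbTE wq) andbF.
  by case zq: (z \in q); rewrite ?orbT ?orbF ?(qR z zq).
have far x z : x \in Y -> z \in q -> ~~ (x -- z).
  move=> xY zq; apply: contra (farY z zq) => xz; apply/adjacentP.
  by exists x, z; rewrite inE eqxx.
split.
- split; rewrite ?inE ?aY ?bY //.
    move=> z; rewrite !inE => /orP[/eqP->|/lY->//].
    by rewrite -lp /= -in_cons mem_last orbT.
  apply: (@connected_setU _ _ _ y w) => //; last by rewrite yw orbT.
    exact: connected_set_path.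
  by rewrite inE mem_head.
- by rewrite subUset sub1set !inE eqxx orbT /= (subset_trans RY (subsetUl _ _)).
- by rewrite cardsU1 wR add1n.
- by case: (q) => [|? ?] /=; [apply: leqW | rewrite ltnS].
have [pathP closedP memB] := forest; rewrite BE.
have inps x : x \in [set z in q] -> [set z in q] \in if q is [::] then ps else [set z in q] :: ps.
  by case: (q) => [|? ?]; rewrite ?inE // eqxx.
have psP (P : {set G}) : P \in (if q is [::] then ps else [set z in q] :: ps) ->
    P \in ps \/ P = [set z in q] /\ 0 < size q.
  case: (q) => [|z q']; first by left.
  by rewrite inE => /orP[/eqP->|]; [right | left].
have PY (P : {set G}) x : P \in ps -> x \in P -> x \in Y.
  by move=> Pps xP; have /memB : exists2 P, P \in ps & x \in P by [exists P];
    rewrite inE => /andP[].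
split.
- move=> P /psP[/pathP//|[-> q0]]; split.
    (* Dropping two vertices discards [y] and the red vertex [w]. *)
    by have := is_path_chordless (chordless_path_drop 2 ch); rewrite /= drop0;
      apply.
  by apply: connected_set_path; apply: path_sorted ewq.
- move=> P /psP[Pps|[-> _]] x z xP; rewrite !inE => /orP[zB|zq] xz.
  + by apply: closedP Pps _ _ xP _ xz; rewrite inE.
  + by move: (far x z (PY P x Pps xP) zq); rewrite xz.
  + move: zB => /andP[_ zY]; rewrite inE in xP; rewrite edge_sym in xz.
    by move: (far z x zY xP); rewrite xz.
  + by rewrite zq.
move=> x; rewrite inE;
  split=> [/orP[/memB[P Pps xP]|xq]|[P /psP[Pps|[-> _]] xP]].
- by exists P => //; case: (q) => // ? ?; rewrite inE Pps orbT.
- by exists [set z in q] => //; apply: inps xq.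
- by apply/orP; left; apply/memB; exists P.
by rewrite xP orbT.
Qed.

(** Two terminals are joined by the first blue path, and each further one costs at most one red
    vertex and one blue path. By minimality the set built is the whole graph. *)
Lemma steiner_red_blue (G : sgraph) (S : {set G}) :
  steiner S [set: G] -> S != set0 ->
  red_blue_paths G (#|S| - 2) (#|S| - 2).+1.
Proof.
move=> [_ cG minG] S0.
have [a [b [l [lS size_l]]]] : exists a b l,
    (forall x, x \in S -> x \in [:: a, b & l]) /\ size l = #|S| - 2.
  have : 0 < size (enum S) by rewrite -cardE card_gt0.
  have memS x : x \in S -> x \in enum S by rewrite mem_enum.
  rewrite cardE; case: (enum S) memS => [//|a [|b l]] memS _.
    (* A single terminal serves as both ends of the first path. *)
    by exists a, a, [::]; split=> // x /memS; rewrite !inE => ->.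
  by exists a, b, l; split=> //=; rewrite !subSS subn0.
have [Y [R [ps [[aY bY lY cY] RY cardR size_ps forest]]]] := red_blue_tree a b l cG.
have YE : Y = [set: G].
  apply: minG; rewrite ?subsetT //; apply/subsetP=> x /lS.
  by rewrite !inE => /or3P[/eqP->|/eqP->|/lY].
rewrite YE setTD size_l in forest cardR size_ps.
have inps := linear_forest_components forest.
exists R; split=> //.
  apply: leq_trans _ size_ps.
  apply: leq_trans (card_size ps); apply: subset_leq_card.
  by apply/subsetP=> C /inps.
by move=> C /inps Cps; case: forest => /(_ C Cps)[].
Qed.

(** * Minors *)

Definition touching (G : sgraph) (A B : {set G}) : bool :=
  [disjoint A & B] && adjacent A B.

Lemma touching_sym (G : sgraph) : symmetric (@touching G).
Proof. by move=> A B; rewrite /touching disjoint_sym adjacent_sym. Qed.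

Lemma minor_complete (G : sgraph) (t : nat) (bs : seq {set G}) :
  t <= size bs ->
  {in bs, forall A : {set G}, A != set0 /\ connected_set A} ->
  pairwise (@touching G) bs -> minor (complete_graph t) G.
Proof.
move=> size_bs cbs /(pairwiseP set0) pw.
have ltbs (i : 'I_t) : i < size bs by apply: leq_trans size_bs.
have touch (i j : 'I_t) : i != j -> touching (nth set0 bs i) (nth set0 bs j).
  rewrite neq_ltn => /orP[] ij; last rewrite touching_sym;
    by apply: pw; rewrite ?inE ?ltbs.
exists (fun i : complete_graph t => nth set0 bs (i : 'I_t)); split.
- by move=> i; apply/cbs/mem_nth.
- by move=> i j /touch/andP[].
by move=> i j /touch/andP[].
Qed.

Lemma ordered_triple (T : finType) (d : T -> nat) (N : {set T}) :
  {in N &, injective d} -> 2 < #|N| ->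
  exists a b c, [/\ a \in N, b \in N, c \in N & d a < d b < d c].
Proof.
move=> dinj N2; have [z zN] : exists z, z \in N by apply/card_gt0P/ltnW/ltnW.
case: (@arg_minnP _ z (fun z => z \in N) d zN) => a aN mina.
case: (@arg_maxnP _ z (fun z => z \in N) d zN) => c cN maxc.
have [b] : exists b, b \in N :\: [set a; c].
  apply/card_gt0P; have := cardsID [set a; c] N.
  have : #|N :&: [set a; c]| <= 2.
    by apply: leq_trans (subset_leq_card (subsetIr _ _)) _; rewrite cards2;
      case: (_ != _).
  by clear - N2; lia.
rewrite !inE negb_or => /andP[/andP[ba bc] bN]; exists a, b, c; split=> //.
have le_bc : d b <= d c := maxc b bN.
rewrite !ltn_neqAle mina // le_bc !andbT.
by rewrite eq_sym !(inj_in_eq dinj) // ba.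
Qed.

(* For two terminals [X] is a path, and a vertex with three neighbours on it
   gives a K_4-minor using two parts attached to the ends of the path. *)
Lemma steiner_two_terminals (G : sgraph) (X A1 A2 : {set G}) (s1 s2 v : G) :
  steiner [set s1; s2] X -> v \notin X -> 2 < #|neighbours v :&: X| ->
  connected_set A1 -> connected_set A2 ->
  [disjoint v |: X & A1] -> [disjoint v |: X & A2] -> [disjoint A1 & A2] ->
  adjacent [set s1] A1 -> adjacent [set s2] A2 -> adjacent A1 A2 ->
  minor (complete_graph 4) G.
Proof.
move=> stX vX N3 cA1 cA2 disA1 disA2 dis12 adj1 adj2 adj12.
have [SX cX minX] := stX.
have s1X : s1 \in X by apply: (subsetP SX); rewrite !inE eqxx.
have s2X : s2 \in X by apply: (subsetP SX); rewrite !inE eqxx orbT.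
have [d [p [d0 dinj dlt ordered parent]]] := steiner_bfs stX s1X.
(* At most one terminal remains besides [s1], so the interval from a parent to its child has at most
   one element: the numbering runs along a path. *)
have step x : x \in X -> x != s1 -> d x <= (d (p x)).+1.
  move=> xX xs; have [pX xp dp] := parent x xX xs;
    rewrite -subn_eq0 -addn1 subnDA subn_eq0.
  apply: leq_trans (card_interval _ dinj dlt (dlt x xX)) _.
  rewrite edge_sym in xp; apply: leq_trans (ordered _ _ pX xX xp (ltnW dp)) _.
  have : #|[set s1; s2] :\ s1| <= #|[set s2]|.
    by apply/subset_leq_card/subsetP=> z; rewrite !inE => /andP[/negPf->].
  by rewrite cards1.
have [a [b [c []]]] := @ordered_triple _ d (neighbours v :&: X)
  (fun x y xN yN => dinj x y (subsetP (subsetIr _ _) x xN) (subsetP (subsetIr _ _) y yN)) N3.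
rewrite !inE => /andP[va aX] /andP[vb bX] /andP[vc cX'] /andP[ab bc].
have bs1 : b != s1 by apply/eqP=> eqb; rewrite eqb d0 in ab.
(* Splitting at the middle neighbour [b] of [v] leaves [a] and [c] on different sides. *)
pose T1 := [set z in X | d z < d b]; pose T2 := [set z in X | d b < d z].
have T1X : T1 \subset X by apply/subsetP=> z; rewrite inE => /andP[].
have T2X : T2 \subset X by apply/subsetP=> z; rewrite inE => /andP[].
have low m : connected_set [set z in X | d z <= m].
  apply: (@connected_by_rank _ _ s1 p d); first by rewrite inE s1X d0.
  move=> z; rewrite inE => /andP[zX zm] zs; have [pX zp dp] := parent z zX zs.
  by split=> //; rewrite inE pX (leq_trans (ltnW dp)).
have s1T1 : s1 \in T1 by rewrite inE s1X d0 (leq_ltn_trans _ ab).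
have cT1 : connected_set T1.
  have := low (d b).-1; congr connected_set; apply/setP=> z; rewrite !inE.
  by congr (_ && _); rewrite -ltnS prednK // (leq_ltn_trans _ ab).
have cinT2 : c \in T2 by rewrite inE cX' bc.
(* The first vertex [e] after [b] will be the root of [T2]; its parent is [b]. *)
case: (@arg_minnP _ c (fun z => z \in T2) d cinT2) => e eT2 mine.
have [eX be] : e \in X /\ d b < d e by move: eT2; rewrite inE => /andP[].
have notroot z : z \in T2 -> z != s1.
  by rewrite inE => /andP[_ bz]; apply/eqP=> eqz; rewrite eqz d0 in bz.
have cT2 : connected_set T2.
  apply: (@connected_by_rank _ _ e p d) => // z zT2 ze.
  have zX := subsetP T2X z zT2.
  have [pX zp dp] := parent z zX (notroot z zT2).
  have ltez : d e < d z.
    by rewrite ltn_neqAle mine // (inj_in_eq dinj) // eq_sym ze.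
  split=> //; rewrite inE pX; have := step z zX (notroot z zT2).
  by clear - ltez be; lia.
have pe : p e = b.
  have [pX ep dp] := parent e eX (notroot e eT2).
  apply: dinj => //; apply/eqP; rewrite eqn_leq; apply/andP; split.
    rewrite leqNgt; apply/negP=> bp; have : p e \in T2 by rewrite inE pX.
    by move=> /mine; rewrite leqNgt dp.
  by rewrite -ltnS; apply: leq_trans be (step e eX (notroot e eT2)).
(* Otherwise the segment up to [b] would be a connected set with both terminals that misses [c]. *)
have s2T2 : s2 \in T2.
  rewrite inE s2X ltnNge; apply/negP=> s2b.
  have eqX : [set z in X | d z <= d b] = X.
    apply: minX (low _); last by apply/subsetP=> z; rewrite inE => /andP[].
    by rewrite subUset !sub1set !inE s1X s2X d0 s2b.
  by move: cX'; rewrite -eqX inE leqNgt bc andbF.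
have [pbX bp dpb] := parent b bX bs1.
have ep : e -- p e by have [] := parent e eX (notroot e eT2).
have vT1 : v \notin T1 by apply: contra vX; apply: (subsetP T1X).
have vT2 : v \notin T2 by apply: contra vX; apply: (subsetP T2X).
have notA (A : {set G}) : [disjoint v |: X & A] ->
    v \notin A /\ forall z, z \in X -> z \notin A.
  move=> /disjointFr dis; split; first by rewrite dis ?setU11.
  by move=> z zX; rewrite dis // inE zX orbT.
have [vA1 XA1] := notA A1 disA1; have [vA2 XA2] := notA A2 disA2.
have sT1 : T1 \subset T1 :|: A1 := subsetUl _ _.
have sT2 : T2 \subset T2 :|: A2 := subsetUl _ _.
have joined (T A : {set G}) s : s \in T -> connected_set T -> connected_set A ->
    adjacent [set s] A -> connected_set (T :|: A).
  move=> sT cT cA /adjacentP[s' [x [/set1P-> xA sx]]].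
  by apply: (connected_setU cT cA sT xA); rewrite sx orbT.
(* The branch sets are the two sides with their attached parts, and the single vertices [b] and
   [v]. *)
apply: (@minor_complete _ 4 [:: T1 :|: A1; T2 :|: A2; [set b]; [set v]]) => //.
  move=> A; rewrite !inE => /or4P[] /eqP->; split.
  - by apply/set0Pn; exists s1; rewrite inE s1T1.
  - exact: joined s1T1 _ _ adj1.
  - by apply/set0Pn; exists s2; rewrite inE s2T2.
  - exact: joined s2T2 _ _ adj2.
  - by apply/set0Pn; exists b; rewrite inE.
  - exact: connected_set1.
  - by apply/set0Pn; exists v; rewrite inE.
  - exact: connected_set1.
have adj1v (A : {set G}) x y : x \in A -> x -- y -> adjacent A [set y].
  by move=> xA xy; apply/adjacentP; exists x, y; rewrite inE eqxx.
have dis1v (A : {set G}) x : x \notin A -> [disjoint A & [set x]].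
  by move=> xA; rewrite disjoint_sym disjoints1.
rewrite /= !andbT /touching; apply/and3P; split; last 1 first.
- rewrite dis1v; last by rewrite inE; apply: contra vX => /eqP->.
  by apply: (adj1v _ b); rewrite ?inE ?eqxx // edge_sym.
- apply/and3P; split; apply/andP; split.
  + rewrite disjoint_subset; apply/subsetP=> z; rewrite !inE.
    case/orP=> [/andP[zX zb]|zA1].
      by rewrite negb_or (negbTE (XA2 z zX)) zX -leqNgt ltnW.
    rewrite negb_or (disjointFr dis12 zA1) andbT negb_and.
    by apply/orP; left; apply: contraL zA1; apply: XA1.
  + by apply: adjacentS adj12; apply: subsetUr.
  + by apply: dis1v; rewrite !inE bX ltnn (negbTE (XA1 b bX)).
  + by apply: (adj1v _ (p b)); rewrite ?inE ?pbX ?dpb // edge_sym.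
  + by apply: dis1v; rewrite inE (negbTE vT1).
  + by apply: (adj1v _ a); rewrite ?inE ?aX ?ab // edge_sym.
apply/andP; split; apply/andP; split.
- by apply: dis1v; rewrite !inE bX ltnn (negbTE (XA2 b bX)).
- by apply: (adj1v _ e); rewrite ?inE ?eX ?be // -pe.
- by apply: dis1v; rewrite inE (negbTE vT2).
by apply: (adj1v _ c); rewrite ?inE ?cX' ?bc // edge_sym.
Qed.

(** * Construction of the partition *)

Lemma pairwise_in (T : eqType) (r : rel T) (s : seq T) (x y : T) :
  symmetric r -> pairwise r s -> x \in s -> y \in s -> x != y -> r x y.
Proof.
move=> symr; elim: s => //= z s IH /andP[/allP rz pw].
rewrite !inE => /orP[/eqP->|xs] /orP[/eqP->|ys] neq; last exact: IH.
- by rewrite eqxx in neq.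
- exact: rz.
by rewrite symr; apply: rz.
Qed.

Definition cover_seq (G : sgraph) (hs : seq {set G}) : {set G} :=
  [set x | has (fun A : {set G} => x \in A) hs].

Lemma cover_seqP (G : sgraph) (hs : seq {set G}) (x : G) :
  reflect (exists2 A : {set G}, A \in hs & x \in A) (x \in cover_seq hs).
Proof. by rewrite inE; apply: hasP. Qed.

Lemma cover_seq_rcons (G : sgraph) (hs : seq {set G}) (A : {set G}) :
  cover_seq (rcons hs A) = cover_seq hs :|: A.
Proof. by apply/setP=> x; rewrite !inE has_rcons orbC. Qed.

(** The invariant of the greedy construction, from which the width bound follows. *)
Definition adjacent_clique (G : sgraph) (hs : seq {set G}) : Prop :=
  forall C, C \in components (~: cover_seq hs) ->
  {in hs &, forall A B : {set G},
     A != B -> adjacent C A -> adjacent C B -> adjacent A B}.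

Definition next_part (t : nat) (G : sgraph) (hs : seq {set G})
    (H : {set G}) : Prop :=
  [/\ H != set0 /\ connected_set H, [disjoint cover_seq hs & H],
      exists S : {set G}, [/\ steiner S H, S != set0 & #|S| <= t - 2]
    & forall v, v \notin cover_seq hs -> v \notin H ->
        #|neighbours v :&: H| <= 2 * t - 6].

(** With [C] itself, [t - 1] pairwise adjacent parts would be the branch sets of a complete minor.
    The list [bs] is left free to serve both the construction and the final indexed family. *)
Lemma few_adjacent_parts (t : nat) (G : sgraph) (hs bs : seq {set G})
    (C : {set G}) :
  ~ minor (complete_graph t) G -> adjacent_clique hs ->
  C \in components (~: cover_seq hs) ->
  {in hs, forall A : {set G}, A != set0 /\ connected_set A} ->
  {in hs &, forall A B : {set G}, A != B -> [disjoint A & B]} ->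
  uniq bs -> {subset bs <= [seq A <- hs | adjacent C A]} -> size bs <= t - 2.
Proof.
move=> nominor clique CC chs dis ubs sub.
have [CU C0 cC _] := componentsP CC.
rewrite leqNgt; apply/negP=> lt; apply: nominor.
have bsP A : A \in bs -> A \in hs /\ adjacent C A.
  by move/sub; rewrite mem_filter => /andP[].
apply: (@minor_complete _ t (C :: bs)) => /=; first by clear - lt; lia.
  by move=> A; rewrite inE => /orP[/eqP->//|/bsP[/chs]].
apply/andP; split.
  apply/allP=> A /bsP[Ahs CA]; rewrite /touching CA andbT disjoint_subset.
  apply/subsetP=> x /(subsetP CU); rewrite !inE; apply: contra => xA.
  by apply/hasP; exists A.
rewrite uniq_pairwise in ubs;
  apply: (@sub_in_pairwise _ (mem bs) _ _ _ bs _ ubs); last exact/allP.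
move=> A B /bsP[Ahs CA] /bsP[Bhs CB] /= AB.
by rewrite /touching dis //= (clique C).
Qed.

Lemma exists_next_part (t : nat) (G : sgraph) (hs : seq {set G}) :
  4 <= t -> ~ minor (complete_graph t) G -> adjacent_clique hs ->
  {in hs, forall A : {set G}, A != set0 /\ connected_set A} ->
  {in hs &, forall A B : {set G}, A != B -> [disjoint A & B]} ->
  uniq hs -> cover_seq hs != [set: G] ->
  exists H, next_part t hs H /\ adjacent_clique (rcons hs H).
Proof.
move=> t4 nominor clique chs dis uhs.
rewrite -subTset => /subsetPn[x0 _ x0U].
have x0C : [set x0] \subset ~: cover_seq hs by rewrite sub1set inE.
have [C [CC _ x0inC]] := component_sup (@connected_set1 G x0) x0C (set11 x0).
have [CU _ cC clC] := componentsP CC.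
pose adjs := [seq A <- hs | adjacent C A].
have adjsP A : A \in adjs -> A \in hs /\ adjacent C A.
  by rewrite mem_filter => /andP[].
have uadjs : uniq adjs by apply: filter_uniq.
have size_adjs : size adjs <= t - 2.
  exact: few_adjacent_parts nominor clique CC chs dis uadjs _.
pose f A := odflt x0 [pick x in C | adjacent [set x] A].
have fP A : A \in adjs -> f A \in C /\ adjacent [set f A] A.
  case/adjsP=> _ /adjacentP[x [y [xC yA xy]]]; rewrite /f.
  have xA : adjacent [set x] A by apply/adjacentP; exists x, y; rewrite set11.
  by case: pickP => [z /andP[]//|/(_ x)]; rewrite xC xA.
(* If [C] is adjacent to no part, the vertex [x0] keeps the terminal set non-empty. *)
pose terminals := if adjs is [::] then [:: x0] else map f adjs.
pose S := [set x in terminals].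
have SC : S \subset C.
  apply/subsetP=> x; rewrite inE /terminals; move: fP;
    case: (adjs) => [|A l] fA.
    by rewrite inE => /eqP->.
  by move=> /mapP[B /fA[? _] ->].
have S0 : S != set0.
  apply/set0Pn; rewrite /S /terminals; case: (adjs) => [|A l].
    by exists x0; rewrite !inE.
  by exists (f A); rewrite !inE eqxx.
have cardS : #|S| <= maxn 1 (size adjs).
  rewrite cardsE; apply: leq_trans (card_size _) _; rewrite /terminals.
  by case: (adjs) => //= A l; rewrite size_map; clear; lia.
have St : #|S| <= t - 2 by clear - t4 size_adjs cardS; lia.
have hit A : A \in adjs -> exists2 s, s \in S & adjacent [set s] A.
  move=> Aadj; exists (f A); last by case: (fP A Aadj).
  rewrite inE /terminals; case: (adjs) Aadj => // B l Bl; exact: map_f.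
pose P (X : {set G}) := [&& S \subset X, X \subset C &
  [forall x in X, forall y in X, connect (edge_in X) x y]].
have PC : P C by rewrite /P SC subxx; apply/connected_setP.
(* Choosing [H] of least size inside [C] also covers competitors through a vertex [v] outside [H],
   and it implies minimality by inclusion. *)
case: (@arg_minnP _ C P (fun X => #|X|) PC) => H /and3P[SH HC /connected_setP cH] minH.
have minP (X' : {set G}) : S \subset X' -> X' \subset C -> connected_set X' -> #|H| <= #|X'|.
  by move=> SX' X'C cX'; apply: minH; rewrite /P SX' X'C; apply/connected_setP.
have stH : steiner S H.
  split=> // X' SX' X'H cX'; apply/eqP; rewrite eqEcard X'H minP //.
  exact: subset_trans X'H HC.
have H0 : H != set0.
  by apply: contra_neq S0 => H0; apply/eqP; rewrite -subset0 -H0.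
have HU : H \subset ~: cover_seq hs := subset_trans HC CU.
exists H; split; first split=> //.
- rewrite disjoint_sym disjoint_subset; apply/subsetP=> x /(subsetP HU).
  by rewrite inE.
- by exists S.
- move=> v vU vH; have [vC|vC] := boolP (v \in C); last first.
    suff -> : neighbours v :&: H = set0 by rewrite cards0.
    apply/setP=> u; rewrite !inE; apply/negP=> /andP[vu uH].
    case/negP: vC; apply: clC (subsetP HC u uH) _ _; first by rewrite inE.
    by rewrite edge_sym.
  have le : #|neighbours v :&: H| <= #|S|.+1.
    apply: steiner_neighbours_out => // X' SX' X'vH cX'; apply: minP => //.
    by apply: subset_trans X'vH _; rewrite subUset sub1set vC.
  rewrite leqNgt; apply/negP=> lt.
  (* The chain [2 * t - 6 < #|S| + 1 <= t - 1] leaves only this case. *)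
  have [t4E S2] : t = 4 /\ #|S| = 2 by clear - t4 St le lt; lia.
  rewrite t4E in lt size_adjs nominor; apply: nominor.
  have /eqP size2 : size adjs == 2.
    by rewrite eqn_leq size_adjs /=; clear - cardS S2; lia.
  case adjsE: adjs size2 => [|A1 [|A2 [|]]] // _.
  have A1in : A1 \in adjs by rewrite adjsE !inE eqxx.
  have A2in : A2 \in adjs by rewrite adjsE !inE eqxx orbT.
  have [A1hs CA1] := adjsP A1 A1in; have [A2hs CA2] := adjsP A2 A2in.
  have A12 : A1 != A2 by move: uadjs; rewrite adjsE /= inE andbT.
  have SE : S = [set f A1; f A2].
    by apply/setP=> x; rewrite /S /terminals adjsE !inE.
  have disA A : A \in hs -> [disjoint v |: H & A].
    move=> Ahs; rewrite disjoint_subset; apply/subsetP=> x xvH.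
    have : x \notin cover_seq hs.
      by case/setU1P: xvH => [->//|/(subsetP HU)]; rewrite inE.
    by apply: contra => xA; apply/cover_seqP; exists A.
  have [_ cA1] := chs A1 A1hs; have [_ cA2] := chs A2 A2hs.
  have [_ adj1] := fP A1 A1in; have [_ adj2] := fP A2 A2in.
  rewrite SE in stH.
  apply: (steiner_two_terminals stH vH lt cA1 cA2 (disA A1 A1hs) (disA A2 A2hs)
            (dis A1 A2 A1hs A2hs A12) adj1 adj2).
  exact: clique CC _ _ A1hs A2hs A12 CA1 CA2.
move=> C' C'C; have [C'U /set0Pn[x xC'] cC' _] := componentsP C'C.
have C'old : C' \subset ~: cover_seq hs.
  apply: subset_trans C'U _; rewrite setCS cover_seq_rcons; exact: subsetUl.
have [D [DC C'D xD]] := component_sup cC' C'old xC'.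
(* A remaining component adjacent to [H] lies inside [C], so a part [A] adjacent to it is adjacent
   to [C] and hence to a terminal in [H]. *)
have withH A : A \in hs -> adjacent C' A -> adjacent C' H -> adjacent A H.
  move=> Ahs CA /adjacentP[u [h [uC' hH uh]]].
  have uC : u \in C.
    apply: clC (subsetP HC h hH) (subsetP C'old u uC') _.
    by rewrite edge_sym.
  have C'inC := components_meet CC cC' C'old uC uC'.
  have Aadj : A \in adjs by rewrite mem_filter Ahs (adjacentS C'inC _ CA).
  have [s sS sA] := hit A Aadj; rewrite adjacent_sym.
  by apply: adjacentS sA => //; rewrite sub1set (subsetP SH).
move=> A B;
  rewrite !mem_rcons !inE => /orP[/eqP->|Ahs] /orP[/eqP->|Bhs] AB CA CB.
- by rewrite eqxx in AB.
- by rewrite adjacent_sym; apply: withH.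
- exact: withH.
by apply: clique DC _ _ Ahs Bhs AB _ _; apply: adjacentS C'D _ _.
Qed.

(** Stated on prefixes so that it survives appending a part. The second clause includes the whole
    list, as the choice of the following part requires. *)
Definition good_partition (t : nat) (G : sgraph) (hs : seq {set G}) : Prop :=
  (forall i, i < size hs -> next_part t (take i hs) (nth set0 hs i)) /\
  (forall i, i <= size hs -> adjacent_clique (take i hs)).

(** Each part avoids the cover of its prefix, which gives disjointness; non-emptiness then gives
    distinctness. *)
Lemma good_partition_parts (t : nat) (G : sgraph) (hs : seq {set G}) :
  good_partition t hs ->
  [/\ {in hs, forall A : {set G}, A != set0 /\ connected_set A},
      {in hs &, forall A B : {set G}, A != B -> [disjoint A & B]}
    & uniq hs].
Proof.
move=> [parts _].
have chs : {in hs, forall A : {set G}, A != set0 /\ connected_set A}.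
  by move=> A /(nthP set0)[i ilt <-]; case: (parts i ilt).
have pw : pairwise (fun A B : {set G} => [disjoint A & B]) hs.
  apply/(pairwiseP set0) => i j ilt jlt ij.
  have [_ dis _ _] := parts j jlt; apply: disjointWl dis.
  apply/subsetP=> x xi; apply/cover_seqP; exists (nth set0 hs i) => //.
  by rewrite -(nth_take set0 ij) mem_nth // size_takel ?ij // ltnW.
split=> //.
  by move=> A B Ahs Bhs AB; apply: pairwise_in pw Ahs Bhs AB => X Y;
    apply: disjoint_sym.
rewrite uniq_pairwise; apply: (@sub_in_pairwise _ (mem hs) _ _ _ hs _ pw);
  last exact/allP.
move=> A B Ahs _ disAB; apply/eqP=> AB; have [/set0Pn[x xA] _] := chs A Ahs.
by move: (disjointFr disAB xA); rewrite -AB xA.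
Qed.

(** Induction on the number of uncovered vertices, which drops because each new part is
    non-empty. *)
Lemma exists_good_partition (t : nat) (G : sgraph) :
  4 <= t -> ~ minor (complete_graph t) G ->
  exists hs : seq {set G}, good_partition t hs /\ cover_seq hs = [set: G].
Proof.
move=> t4 nominor.
suff extend n (hs : seq {set G}) : #|~: cover_seq hs| < n -> good_partition t hs ->
    exists hs', good_partition t hs' /\ cover_seq hs' = [set: G].
  by apply: (extend _ [::]) (ltnSn _) _; split=> // i _ C _ A B.
elim: n hs => // n IH hs lt_n good.
have [covT|nU] := eqVneq (cover_seq hs) [set: G]; first by exists hs.
have [chs dis uhs] := good_partition_parts good.
have [parts cliques] := good.
have clique : adjacent_clique hs by rewrite -(take_size hs); apply: cliques.
have [H [partH cliqueH]] := exists_next_part t4 nominor clique chs dis uhs nU.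
have take_hs i : i <= size hs -> take i (rcons hs H) = take i hs.
  by move=> ile; rewrite -cats1 takel_cat.
apply: (IH (rcons hs H)).
  rewrite -ltnS; apply: leq_trans lt_n; rewrite ltnS.
  have [[/set0Pn[x xH] _] disH _ _] := partH.
  apply/proper_card/properP; split;
    first by rewrite setCS cover_seq_rcons subsetUl.
  exists x; last by rewrite cover_seq_rcons !inE xH orbT.
  by rewrite inE (disjointFl disH xH).
split=> i; rewrite size_rcons ?ltnS => ile.
  rewrite take_hs // nth_rcons; move: ile;
    rewrite leq_eqVlt => /orP[/eqP->|ilt].
    by rewrite ltnn eqxx take_size.
  by rewrite ilt; apply: parts.
move: ile; rewrite leq_eqVlt => /orP[/eqP->|ilt].
  by rewrite -(size_rcons hs H) take_size.
by rewrite take_hs //; apply: cliques.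
Qed.

(** * Degree, width and colouring bounds for the parts *)

Lemma steiner_part (t : nat) (G : sgraph) (S H : {set G}) :
  4 <= t -> steiner S H -> S != set0 -> #|S| <= t - 2 ->
  [/\ max_degree (induced H) <= t - 2,
      [/\ bandwidth_le (induced H) (t - 3), pathwidth_le (induced H) (t - 3)
        & treewidth_le (induced H) (t - 3)],
      clustered_2colourable (induced H) (uphalf (t - 2))
    & red_blue_paths (induced H) (t - 4) (t - 3)].
Proof.
move=> t4 stH S0 St; have [K [stK cardK]] := steiner_induced stH.
rewrite -cardK in St.
have K0 : K != set0 by rewrite -card_gt0 cardK card_gt0.
have cardH : 0 < #|induced H|.
  by have /set0Pn[x _] := K0; apply/card_gt0P; exists x.
have bw : bandwidth_le (induced H) (t - 3).
  have [f [fbij fK]] := steiner_bandwidth stK K0; exists f;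
    split=> // x y /fK[le1 le2].
  by split; [apply: leq_trans le1 _ | apply: leq_trans le2 _]; clear - St; lia.
split.
- apply/bigmax_leqP=> x _; apply: leq_trans St.
  by have := steiner_degree stK (in_setT x); rewrite setIT.
- by split=> //; [apply: bandwidth_pathwidth | apply: bandwidth_treewidth].
- have [f fK] := steiner_2colourable stK K0; exists f => b C /fK le.
  by apply: leq_trans le _; clear - St; lia.
have [R [R1 R2 R3]] := steiner_red_blue stK K0; exists R; split=> //.
  by apply: leq_trans R1 _; clear - St; lia.
by apply: leq_trans R2 _; clear - St t4; lia.
Qed.

Theorem theorem11 (t : nat) (G : sgraph) :
  4 <= t ->
  ~ minor (complete_graph t) G ->
  exists (l : nat) (H : 'I_l -> {set G}),
    [/\ connected_partition H,
        partition_width H (t - 2)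
      & forall i : 'I_l,
        [/\ max_degree (induced (H i)) <= t - 2,
            [/\ bandwidth_le (induced (H i)) (t - 3),
                pathwidth_le (induced (H i)) (t - 3)
              & treewidth_le (induced (H i)) (t - 3)],
            clustered_2colourable (induced (H i)) (uphalf (t - 2)),
            red_blue_paths (induced (H i)) (t - 4) (t - 3)
          & forall C : {set G}, C \in components (~: upto H i) ->
            [/\ #|adjacent_parts H i C| <= t - 2,
                {in adjacent_parts H i C &, forall j k : 'I_l,
                  j != k -> adjacent (H j) (H k)}
              & forall v : G, v \in C -> forall j : 'I_l, j <= i ->
                  #|neighbours v :&: H j| <= 2 * t - 6]]].
Proof.
move=> t4 nominor; have [hs [good coverT]] := exists_good_partition t4 nominor.
have [chs dis uhs] := good_partition_parts good; have [parts cliques] := good.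
pose H (i : 'I_(size hs)) := nth set0 hs i.
have Hhs i : H i \in hs by apply: mem_nth.
have neqH i j : i != j -> H i != H j by rewrite /H nth_uniq.
(* [upto] includes its own index, hence the prefix of length [i.+1]. *)
have takeP (i : 'I_(size hs)) A : reflect (exists2 j : 'I_(size hs), j <= i & A = H j)
    (A \in take i.+1 hs).
  have sizeE : size (take i.+1 hs) = i.+1 by rewrite size_takel.
  apply: (iffP (nthP set0)) => [[j]|[j ji ->]]; rewrite sizeE.
    move=> ji <-; have jlt : j < size hs by apply: leq_trans ji (ltn_ord i).
    by exists (Ordinal jlt) => //; rewrite nth_take.
  by exists j; rewrite ?sizeE ?ltnS // nth_take.
have uptoE i : upto H i = cover_seq (take i.+1 hs).
  apply/setP=> x;
    apply/bigcupP/cover_seqP => [[j ji xj]|[A /takeP[j ji ->] xj]].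
    by exists (H j) => //; apply/takeP; exists j.
  by exists j.
have cliqueH i C : C \in components (~: upto H i) ->
    {in adjacent_parts H i C &, forall j k, j != k -> adjacent (H j) (H k)}.
  rewrite uptoE => CC j k; rewrite !inE => /andP[ji Cj] /andP[ki Ck] jk.
  apply: (cliques i.+1 (ltn_ord i) C CC) => //; last exact: neqH.
    by apply/takeP; exists j.
  by apply/takeP; exists k.
have fewH i C : C \in components (~: upto H i) -> #|adjacent_parts H i C| <= t - 2.
  rewrite uptoE => CC; rewrite cardE -(size_map H).
  have sub A : A \in take i.+1 hs -> A \in hs by apply: mem_take.
  apply: (few_adjacent_parts nominor (cliques i.+1 (ltn_ord i)) CC).
  - by move=> A /sub/chs.
  - by move=> A B /sub Ahs /sub; apply: dis.
  - rewrite map_inj_uniq ?enum_uniq // => j k eqH; apply/eqP.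
    by apply: contraT => /neqH; rewrite eqH eqxx.
  move=> _ /mapP[j + ->]; rewrite mem_enum inE => /andP[ji Cj].
  by rewrite mem_filter Cj; apply/takeP; exists j.
exists (size hs), H; split.
- split.
  + by move=> i; apply/chs/Hhs.
  + by move=> i j ij; apply: dis => //; apply: neqH.
  apply/setP=> x; rewrite inE; apply/bigcupP.
  have /cover_seqP[A /(nthP set0)[i ilt <-] xi] : x \in cover_seq hs by rewrite coverT inE.
  by exists (Ordinal ilt).
- by move=> i _ C; apply: fewH.
move=> i; have [_ _ [S [stS S0 St]] _] := parts i (ltn_ord i).
have [deg widths col redblue] := steiner_part t4 stS S0 St.
split=> // C CC; split; [exact: fewH | exact: cliqueH |].
(* The bound recorded when part [j] was chosen holds for every vertex outside the parts up to [j],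
   in particular for those of [C]. *)
move=> v vC j ji; have [_ _ _ nbrs] := parts j (ltn_ord j).
have [CU _ _ _] := componentsP CC.
have vU : v \notin upto H i by move: (subsetP CU v vC); rewrite inE.
have vH (k : 'I_(size hs)) : k <= i -> v \notin H k.
  by move=> ki; apply: contra vU => vk; apply/bigcupP; exists k.
apply: nbrs; last exact: vH.
apply/cover_seqP=> -[A Aj vA].
have : A \in take j.+1 hs by apply: (@mem_take j); rewrite take_takel.
case/takeP=> k kj AE; have := vH k (leq_trans kj ji).
by rewrite -AE vA.
Qed.
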